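(* For all positive integers $p$ and $m$, let $J_p=\sum_{j=1}^{p-1}j\cot\left(\frac{j\pi}{p}\right)$ and let $H_p=\sum_{j=1}^p\frac1j$. Then there is a real number $\theta_{p,m}$ such that $$J_p=-\frac1\pi p^2H_p+\frac{\ln(2\pi)}{\pi}p^2-\frac{p}{2\pi}-\sum_{k=1}^{m-1}\frac{b_{2k}(1+2\zeta(2k))}{2\pi k\cdot p^{2k-2}}+\frac{(-1)^m}{p^{2m-2}}\,\theta_{p,m}$$ and $$0<\theta_{p,m}<\frac{|b_{2m}|(1+2\zeta(2m))}{2\pi m}.$$
   Context: The Bernoulli polynomials $(B_n)_{n\ge 0}$ are the unique sequence of real polynomials with $B_0(X)=1$ and, for all $n\ge1$, $B_n(X+1)-B_n(X)=nX^{n-1}$ and $\int_0^1B_n(t)\,dt=0$; the Bernoulli numbers are $b_n=B_n(0)$. $\zeta$ is the Riemann zeta function. Empty sums are $0$. *)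

(* Defs.v *)
From HB Require Import structures.
From mathcomp Require Import all_boot all_order all_algebra.
From mathcomp Require Import all_classical all_reals all_analysis.

Set Implicit Arguments.
Unset Strict Implicit.
Unset Printing Implicit Defensive.

Import Order.TTheory GRing.Theory Num.Theory.
Import numFieldNormedType.Exports.

Local Open Scope classical_set_scope.
Local Open Scope ring_scope.

Definition is_bernoulli_polys (R : realType) (B : nat -> {poly R}) : Prop :=
  B 0%N = 1 /\
  forall n : nat, (0 < n)%N ->
    B n \Po ('X + 1) - B n = n%:R *: 'X^(n.-1) /\
    \int[lebesgue_measure]_(t in `[0, 1]) (B n).[t] = 0.

Lemma Rintegral01_addC (R : realType) (p : {poly R}) (c : R) :
  \int[lebesgue_measure]_(t in `[0, 1]) (p + c%:P).[t] =
  \int[lebesgue_measure]_(t in `[0, 1]) p.[t] + c.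
Proof.
have int_horner (q : {poly R}) :
    lebesgue_measure.-integrable `[0, 1] (EFin \o horner q).
  apply: continuous_compact_integrable; first exact: segment_compact.
  by apply: continuous_subspaceT => x; exact: continuous_horner.
under eq_Rintegral do rewrite hornerD.
rewrite RintegralD//; congr (_ + _).
under eq_Rintegral do rewrite hornerC.
rewrite Rintegral_cst//=.
have -> : lebesgue_measure (`[0, 1] : set R) = 1%E.
  by rewrite lebesgue_measure_itv/= lte01 oppr0 adde0.
by rewrite mulr1.
Qed.

Lemma difference_Xn (R : realType) (n : nat) :
  exists p : {poly R}, p \Po ('X + 1) - p = 'X^n.
Proof.
elim/ltn_ind: n => n IH.
have /choice[P PE] (i : 'I_n) : exists p : {poly R}, p \Po ('X + 1) - p = 'X^i.
  exact: IH.
set S := \sum_(i < n) P i *+ 'C(n.+1, i).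
have SE : S \Po ('X + 1) - S = \sum_(i < n) 'X^i *+ 'C(n.+1, i).
  rewrite /S raddf_sum/= -sumrB; apply: eq_bigr => i _.
  by rewrite raddfMn/= -mulrnBl PE.
have XE : ('X^(n.+1) \Po ('X + 1) - 'X^(n.+1) : {poly R}) =
    \sum_(i < n) 'X^i *+ 'C(n.+1, i) + 'X^n *+ n.+1.
  rewrite comp_Xn_poly exprD1n !big_ord_recr/= binn mulr1n addrK.
  by congr (_ + _ *+ _); rewrite binSn.
have SXE : ('X^(n.+1) - S) \Po ('X + 1) - ('X^(n.+1) - S) = 'X^n *+ n.+1.
  by rewrite comp_polyB opprD addrACA -opprD XE SE addrAC subrr add0r.
exists (n.+1%:R^-1 *: ('X^(n.+1) - S)).
by rewrite comp_polyZ -scalerBr SXE -scalerMnr scalerMnl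
  -mulr_natr mulVf ?scale1r//.
Qed.

Lemma bernoulli_polys_exist (R : realType) :
  exists B : nat -> {poly R}, is_bernoulli_polys B.
Proof.
have /choice[P PE] := @difference_Xn R.
pose Q n : {poly R} := n%:R *: P n.-1.
pose B n : {poly R} := if n is 0%N then 1 else
  Q n + (- \int[lebesgue_measure]_(t in `[0, 1]) (Q n).[t])%:P.
exists B; split=> // -[//|n] _; split; last first.
  by rewrite Rintegral01_addC subrr.
rewrite /B comp_polyD comp_polyC opprD addrACA subrr addr0 /Q.
by rewrite comp_polyZ -scalerBr PE.
Qed.

Lemma bernoulli_polys_unique (R : realType) (B C : nat -> {poly R}) :
  is_bernoulli_polys B -> is_bernoulli_polys C -> B = C.
Proof.
move=> [B0 BE] [C0 CE]; apply/funext => -[|n]; first by rewrite B0 C0.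
have [Bd Bi] := BE n.+1 isT; have [Cd Ci] := CE n.+1 isT.
set D := B n.+1 - C n.+1.
have Dd : D \Po ('X + 1) = D.
  apply/eqP; rewrite -subr_eq0 /D comp_polyB opprD addrACA -opprD.
  by rewrite Bd Cd subrr.
have Dn k : D.[k%:R] = D.[0].
  elim: k => [//|k <-].
  by rewrite -[in RHS]Dd horner_comp !hornerE -natr1.
have DE : D = (D.[0])%:P.
  apply/eqP; rewrite -subr_eq0; apply/eqP.
  apply: (@roots_geq_poly_eq0 _ _ [seq k%:R | k <- iota 0 (size (D - (D.[0])%:P))]).
  - by apply/allP => _ /mapP[k _ ->]; rewrite /root hornerD hornerN hornerC Dn subrr.
  - by rewrite map_inj_uniq ?iota_uniq// => i j /eqP; rewrite eqr_nat => /eqP.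
  - by rewrite size_map size_iota.
have BCE : B n.+1 = C n.+1 + (D.[0])%:P by rewrite -DE addrC subrK.
by move: Bi; rewrite BCE Rintegral01_addC Ci add0r => ->; rewrite addr0.
Qed.

Definition bernoulli_poly (R : realType) : nat -> {poly R} :=
  sval (cid (bernoulli_polys_exist R)).

Lemma bernoulli_polyP (R : realType) : is_bernoulli_polys (@bernoulli_poly R).
Proof. exact: svalP (cid (bernoulli_polys_exist R)). Qed.

Definition bernoulli_number (R : realType) (n : nat) : R :=
  (bernoulli_poly R n).[0].

(* The Dirichlet series agrees with the Riemann zeta function only for s > 1;
   for other s, where it diverges, the value is meaningless. *)
Definition zeta (R : realType) (s : R) : R :=
  limn (series (fun n : nat => n.+1%:R `^ (- s))).

Definition cot (R : realType) (x : R) : R := cos x / sin x.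

Definition cot_sum (R : realType) (p : nat) : R :=
  \sum_(1 <= j < p) j%:R * cot (j%:R * pi / p%:R).

Definition harmonic_number (R : realType) (p : nat) : R :=
  \sum_(1 <= j < p.+1) 1 / j%:R.

(* Main.v *)
(* Expanding pi cot(pi x) into simple poles, J_p becomes a limit over N of finite
   combinations of the harmonic numbers H_(kp), k <= N.  Write
   H_n = ln n + gamma + 1/(2n) - g(n); by Stirling's formula the logarithms
   contribute ln(2 pi), and
     pi J_p / p^2 = - H_p + ln(2 pi) - 1/(2p) - (g(p) + 2 sum_(k >= 1) g(kp)).
   Euler-Maclaurin for 1/x shows that the partial sums of
   sum_j b_(2j) / (2j n^(2j)) are alternately below and above g(n).  Summing this
   over n = p and twice over n = kp, k >= 1, turns n^(-2j) into
   p^(-2j) (1 + 2 zeta(2j)), and the alternation gives both bounds on theta. *)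
Require Import Defs.
From mathcomp Require Import all_boot all_order all_algebra.
From mathcomp Require Import all_classical all_reals all_analysis.
From mathcomp Require Import ring lra.
Import Order.TTheory GRing.Theory Num.Theory.
Import numFieldNormedType.Exports.
Local Open Scope ring_scope.
Set Implicit Arguments.
Unset Strict Implicit.

(** Both bounds on theta come from one signed error E_m: it is positive for every m, and E_m +
    E_(m+1) is exactly the first omitted term, so E_m lies strictly between 0 and that term. Since
    limits preserve only weak inequalities, the contribution of n = p is kept outside the limit over
    N and supplies the strictness. The cotangent expansion follows Herglotz, with a rate:
    [pi cot(pi x)] and its truncated pole sum obey the same duplication formula, provided that the
    truncation doubles as well. The expansion is therefore obtained along N = 2^r only, with error
    O(2^-r), and the final limits are taken along this subsequence. The Euler-Maclaurin remainder is
    treated without integrals: it is the increment of an explicit function whose derivative has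
    constant sign. Euler's constant enters through the numbers H_(kp) and cancels against the one in
    g(p). *)

(** * Mean values, and calculus of polynomials *)

Lemma mvt_is_derive (R : realType) (f df : R -> R) (x y : R) : x < y ->
  (forall t, x <= t <= y -> is_derive t 1 f (df t)) ->
  exists2 c, x < c < y & f y - f x = df c * (y - x).
Proof.
move=> xy fE; have [||c] := @MVT R f df x y xy.
- by move=> z; rewrite in_itv/= => /andP[xz zy]; apply: fE; rewrite !ltW.
- by apply: derivable_within_continuous => z; rewrite in_itv/= => /fE[].
- by rewrite in_itv/= => cxy E; exists c.
Qed.

Lemma integral01_deriv (R : realType) (q : {poly R}) :
  \int[lebesgue_measure]_(t in `[0, 1]) (q^`()).[t] = q.[1] - q.[0].
Proof.
have cts (p : {poly R}) (D : set R) : {within D, continuous (horner p)}%classic.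
  by apply: continuous_subspaceT => x; exact: continuous_horner.
have /= := @continuous_FTC2 R (horner q^`()) (horner q) 0 1 ltr01 (cts _ _).
rewrite /Rintegral => -> //.
  split; first by move=> x _; exact: derivable_horner.
  - exact/cvg_at_right_filter/continuous_horner.
  - exact/cvg_at_left_filter/continuous_horner.
by move=> x _; rewrite -derivE.
Qed.

Lemma poly_antideriv (R : realType) (p : {poly R}) : exists q : {poly R}, q^`() = p.
Proof.
exists (\poly_(i < (size p).+1) (p`_i.-1 / i%:R)); apply/polyP => i.
rewrite coef_deriv coef_poly ltnS; case: ltnP => [_|ip]; last first.
  by rewrite mul0rn nth_default.
by rewrite /= -[LHS]mulr_natr divfK// pnatr_eq0.
Qed.

(** Subtracting [p.[0]] leaves a polynomial that vanishes at every natural number, hence zero. *)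
Lemma periodic_poly_const (R : realType) (p : {poly R}) :
  p \Po ('X + 1) = p -> p = (p.[0])%:P.
Proof.
move=> pp; have pn k : p.[k%:R] = p.[0].
  elim: k => [//|k <-].
  by rewrite -[in RHS]pp horner_comp !hornerE -natr1.
apply/eqP; rewrite -subr_eq0; apply/eqP.
apply: (@roots_geq_poly_eq0 _ _ [seq k%:R | k <- iota 0 (size (p - (p.[0])%:P))]).
- by apply/allP => _ /mapP[k _ ->]; rewrite /root hornerD hornerN hornerC pn subrr.
- by rewrite map_inj_uniq ?iota_uniq// => i j /eqP; rewrite eqr_nat => /eqP.
- by rewrite size_map size_iota.
Qed.

(** * Bernoulli polynomials *)

Section BernoulliPolynomials.
Variable R : realType.
Local Notation B := (bernoulli_poly R).
Local Notation b := (bernoulli_number R).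

Lemma bernoulli_poly_diff n : B n.+1 \Po ('X + 1) - B n.+1 = n.+1%:R *: 'X^n.
Proof. by have [_ /(_ n.+1 isT)[]] := bernoulli_polyP R. Qed.

Lemma bernoulli_poly_int n :
  \int[lebesgue_measure]_(t in `[0, 1]) (B n.+1).[t] = 0.
Proof. by have [_ /(_ n.+1 isT)[]] := bernoulli_polyP R. Qed.

Lemma bernoulli_poly0 : B 0 = 1.
Proof. by have [] := bernoulli_polyP R. Qed.

Lemma bernoulli_poly_diff01 n : (B n.+1).[1] - (B n.+1).[0] = (n == 0%N)%:R.
Proof.
have := congr1 (horner^~ 0) (bernoulli_poly_diff n).
rewrite hornerD hornerN horner_comp !hornerE => ->.
by case: n => [|n]; rewrite ?hornerXn expr0n ?mulr1 ?mulr0.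
Qed.

(** [B 1 - 'X] is 1-periodic, hence constant. The leading coefficient is all that differentiation
    needs; the reflection formula fixes [c] later. *)
Lemma bernoulli_poly1_monic : exists c, B 1 = 'X + c%:P.
Proof.
exists (B 1 - 'X).[0]; rewrite -periodic_poly_const ?subrKC//.
apply/eqP; rewrite -subr_eq0 comp_polyB comp_polyX opprB.
have /eqP := bernoulli_poly_diff 0; rewrite subr_eq => /eqP ->.
by rewrite scale1r expr0; apply/eqP; ring.
Qed.

(** The normalised derivatives [C n] satisfy the defining conditions, so uniqueness identifies them
    with [B n]. Their integrals vanish because [B n] takes equal values at 0 and 1 once n >= 2. *)
Lemma deriv_bernoulli_poly n : (B n.+1)^`() = n.+1%:R *: B n.
Proof.
pose C n := n.+1%:R^-1 *: (B n.+1)^`().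
suff /(bernoulli_polys_unique (bernoulli_polyP R)) BC : is_bernoulli_polys C.
  have -> : B n = C n by rewrite BC.
  by rewrite /C scalerA divff ?scale1r// pnatr_eq0.
split=> [|[//|m] _].
  have [c Bc] := bernoulli_poly1_monic.
  by rewrite /C invr1 scale1r Bc derivD derivC derivX addr0.
split.
  have := congr1 (@deriv R) (bernoulli_poly_diff m.+1).
  rewrite derivB derivZ derivXn deriv_comp derivD derivX derivC addr0 mulr1 /=.
  rewrite /C comp_polyZ -scalerBr => ->.
  by rewrite scalerA mulVf ?pnatr_eq0// scale1r scaler_nat.
rewrite /C.
under eq_Rintegral do rewrite -derivZ.
rewrite integral01_deriv !hornerZ -mulrBr bernoulli_poly_diff01 mulr0//.
Qed.

Lemma bernoulli_poly_reflect n : B n \Po (1 - 'X) = (-1) ^+ n *: B n.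
Proof.
have comp1 (q : {poly R}) : 1 \Po q = 1 by rewrite -polyC1 comp_polyC.
pose C n := (-1) ^+ n *: (B n \Po (1 - 'X)).
suff /(bernoulli_polys_unique (bernoulli_polyP R)) BC : is_bernoulli_polys C.
  have {2}-> : B n = C n by rewrite BC.
  by rewrite /C scalerA -expr2 sqrr_sign scale1r.
split=> [|[//|m] _]; first by rewrite /C bernoulli_poly0 comp1 scale1r.
split.
  have := congr1 (fun p => p \Po - 'X) (bernoulli_poly_diff m).
  rewrite comp_polyB comp_polyZ -comp_polyA comp_polyD comp_polyX comp1.
  rewrite comp_Xn_poly [- 'X + 1]addrC => BE.
  rewrite /C comp_polyZ -comp_polyA comp_polyB comp_polyX comp1.
  rewrite -scalerBr opprD addrCA subrr addr0 -[X in _ *: X]opprB BE.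
  rewrite [(- 'X) ^+ m]exprNn exprS mulN1r scaleNr scalerN opprK.
  have -> : (-1) ^+ m * 'X^m = ((-1) ^+ m : R) *: 'X^m :> {poly R}.
    rewrite -(signr_odd _ m) -(signr_odd R m).
    by case: (odd m); rewrite ?expr1 ?expr0 ?mulN1r ?scaleN1r ?mul1r ?scale1r.
  by rewrite !scalerA mulrAC -expr2 sqrr_sign mul1r.
(* The substitution 1 - t under the integral is carried out on an antiderivative [q]: what remains
   is a multiple of [q.[0] - q.[1]], that is, of the integral of [B m.+1]. *)
have [q qE] := poly_antideriv (B m.+1).
have CE : C m.+1 = ((- (-1) ^+ m.+1) *: (q \Po (1 - 'X)))^`().
  rewrite derivZ deriv_comp qE derivB derivX derivC sub0r mulrN1 /C scalerN.
  by rewrite scaleNr opprK.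
under eq_Rintegral do rewrite CE.
rewrite integral01_deriv !hornerZ !horner_comp !hornerE subrr subr0 -mulrBr.
rewrite -[_ - _]opprB -integral01_deriv qE bernoulli_poly_int oppr0 mulr0//.
Qed.

Lemma bernoulli_poly_onem n x : (B n).[1 - x] = (-1) ^+ n * (B n).[x].
Proof.
by rewrite -hornerZ -bernoulli_poly_reflect horner_comp !hornerE.
Qed.

Lemma bernoulli_poly1 : B 1 = 'X - (2^-1)%:P.
Proof.
have [c B1E] := bernoulli_poly1_monic.
have := bernoulli_poly_onem 1 0; rewrite B1E !hornerE => cN.
rewrite -polyCN; congr (_ + _%:P); lra.
Qed.

Lemma bernoulli_poly_odd n : (0 < n)%N -> (B n.*2.+1).[0] = 0.
Proof.
case: n => // n _; have := bernoulli_poly_diff01 n.+1.*2.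
have := bernoulli_poly_onem n.+1.*2.+1 0.
rewrite subr0 exprS -signr_odd odd_double expr0 mulr1 mulN1r => -> /=; lra.
Qed.

Lemma bernoulli_poly_odd_half n : (B n.*2.+1).[2^-1] = 0.
Proof.
have := bernoulli_poly_onem n.*2.+1 2^-1.
have -> : 1 - 2^-1 = 2^-1 :> R by lra.
by rewrite exprS -signr_odd odd_double expr0 mulr1 mulN1r; lra.
Qed.

Lemma poly_mvt (q : {poly R}) (x y : R) : x < y ->
  exists2 c, x < c < y & q.[y] - q.[x] = q^`().[c] * (y - x).
Proof. by move=> xy; apply: (mvt_is_derive xy) => t _; exact: is_derive_poly. Qed.

(** If [q.[x] >= 0], mean values give a slope >= 0 left of [x] and a slope <= 0 right of it, against
    the strict growth of the derivative. *)
Lemma poly_convex_lt0 (q : {poly R}) (y x z : R) : y < x -> x < z ->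
  q.[y] = 0 -> q.[z] = 0 -> (forall t, y < t < z -> 0 < q^`()^`().[t]) -> q.[x] < 0.
Proof.
move=> yx xz qy qz q2.
have [c /andP[yc cx]] := poly_mvt q yx.
have [d /andP[xd dz]] := poly_mvt q xz.
rewrite qy qz subr0 sub0r => qd qc.
have [e /andP[ce ed]] := poly_mvt q^`() (lt_trans cx xd).
have cd : 0 < d - c by rewrite subr_gt0 (lt_trans cx).
have e0 : 0 < q^`()^`().[e].
  by rewrite q2// (lt_trans yc ce) (lt_trans ed dz).
move=> E; have cd1 : q^`().[c] < q^`().[d] by rewrite -subr_gt0 E mulr_gt0.
rewrite ltNge; apply/negP => q0; move: cd1; apply/negP; rewrite -leNgt.
have c0 : 0 <= q^`().[c] by rewrite -(pmulr_lge0 _ (_ : 0 < x - y)) ?subr_gt0// -qc.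
have d0 : q^`().[d] <= 0.
  by rewrite -(pmulr_lle0 _ (_ : 0 < z - x)) ?subr_gt0// -qd oppr_le0.
exact: le_trans d0 c0.
Qed.

(* B_(2n+3) vanishes at 0 and 1/2, and its second derivative is a positive
   multiple of B_(2n+1), so convexity alternates the signs. *)
Lemma bernoulli_poly_odd_sign n x : 0 < x < 2^-1 ->
  0 < (-1) ^+ n.+1 * (B n.*2.+1).[x].
Proof.
elim: n x => [|n IH] x /andP[x0 x2].
  by rewrite bernoulli_poly1 !hornerE; lra.
pose q := (-1) ^+ n.+1 *: B n.+1.*2.+1.
suff : q.[x] < 0 by rewrite exprS mulN1r mulNr oppr_gt0 hornerZ.
apply: (@poly_convex_lt0 q 0 x 2^-1) => //.
- by rewrite hornerZ bernoulli_poly_odd ?mulr0.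
- by rewrite hornerZ bernoulli_poly_odd_half ?mulr0.
move=> t t2; rewrite /q doubleS !derivZ !deriv_bernoulli_poly derivZ.
rewrite deriv_bernoulli_poly !hornerZ mulrCA mulr_gt0// ?ltr0n//.
by rewrite mulrCA mulr_gt0// ?ltr0n// IH.
Qed.

(** Reflection reduces to [x <= 1/2]; there the difference is a positive multiple of B_(2n+1) at a
    mean value point in (0, 1/2), where the sign is known. *)
Lemma bernoulli_poly_even_sign n x : 0 < x < 1 ->
  0 < (-1) ^+ n.+1 * ((B n.+1.*2).[x] - b n.+1.*2).
Proof.
wlog : x / x <= 2^-1.
  move=> H x01; have [/H|x2] := leP x 2^-1; first exact.
  have := H (1 - x); rewrite bernoulli_poly_onem -[(-1) ^+ n.+1.*2]signr_odd odd_double mul1r.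
  by apply; lra.
move=> x2 /andP[x0 x1]; rewrite /bernoulli_number.
have [c /andP[c0 cx] ->] := poly_mvt (B n.+1.*2) x0.
rewrite doubleS deriv_bernoulli_poly hornerZ subr0 mulrA mulrCA mulrC.
rewrite mulr_gt0// mulr_gt0 ?ltr0n//.
by apply: bernoulli_poly_odd_sign; rewrite c0 (lt_le_trans cx).
Qed.

End BernoulliPolynomials.

(** * Asymptotics of the harmonic numbers *)

Section EulerMaclaurin.
Variable R : realType.
Local Notation B := (bernoulli_poly R).
Local Notation b := (bernoulli_number R).
Implicit Types (x t : R) (m n k : nat).

Lemma is_derive_expVn x n t : 0 < x + t ->
  is_derive t 1 (fun s => (x + s) ^- n) (- n%:R * (x + t) ^- n.+1).
Proof.
move=> xt0; have dx : is_derive t 1 (fun s : R => x + s) 1.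
  by apply: is_derive_eq (is_deriveD (is_derive_cst x t 1) (is_derive_id t 1)) _; rewrite add0r.
have xn0 : (x + t) ^+ n != 0 by rewrite expf_neq0// gt_eqF.
rewrite (_ : (fun s => _) = (fun y => (((fun s : R => x + s) ^+ n) y)^-1)); last first.
  by apply/funext => s; rewrite exprfctE.
have xn0' : ((fun s : R => x + s) ^+ n) t != 0 by rewrite exprfctE.
apply: is_derive_eq (is_deriveV xn0' (is_deriveX n dx)) _.
rewrite exprfctE /GRing.scale/= mulr1; case: n xn0 {xn0'} => [|n] _.
  by rewrite mul0r mulr0 oppr0 mul0r.
have xn : x + t != 0 by rewrite gt_eqF.
rewrite /= !exprSr.
by move: (n.+1%:R : R) ((x + t) ^+ n) (expf_neq0 n xn) => N u u0; field; rewrite xn u0.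
Qed.

Lemma is_derive_bernoulli_term x n t : 0 < x + t ->
  is_derive t 1 (fun s => n.+1%:R^-1 * ((B n.+1).[s] * (x + s) ^- n.+1))
    ((B n).[t] * (x + t) ^- n.+1 - (B n.+1).[t] * (x + t) ^- n.+2).
Proof.
move=> xt0.
have H := is_deriveM (is_derive_poly (B n.+1) t) (is_derive_expVn n.+1 xt0).
apply: is_derive_eq (is_deriveZ (n.+1%:R^-1) H) _.
rewrite deriv_bernoulli_poly hornerZ /GRing.scale/=.
have nn : n.+1%:R != 0 :> R by rewrite pnatr_eq0.
rewrite exprS; move: ((x + t) ^+ n.+1) (expf_neq0 n.+1 (lt0r_neq0 xt0)) => u u0.
by move: (n.+1%:R : R) nn (lt0r_neq0 xt0) => N N0 xt; field; rewrite xt u0.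
Qed.

(* Since B_n' = n B_(n-1), differentiating B_n(t) / (n (x + t)^n) telescopes, so
   that only the last Bernoulli polynomial survives in the derivative. *)
Definition em_antideriv x m t : R :=
  - ln (x + t) + (B 1).[t] / (x + t) +
  \sum_(1 <= k < m) ((k.*2)%:R^-1 * ((B k.*2).[t] * (x + t) ^- k.*2) +
    (k.*2.+1)%:R^-1 * ((B k.*2.+1).[t] * (x + t) ^- k.*2.+1)).

(** The derivative of [- ln (x + t)] is -B_0 / (x + t), so the logarithm starts the telescope. *)
Lemma is_derive_em_antideriv x m t : 0 < x + t ->
  is_derive t 1 (em_antideriv x m.+1) (- ((B m.*2.+1).[t] * (x + t) ^- m.*2.+2)).
Proof.
move=> xt0; elim: m => [|m IH].
  have dx : is_derive t 1 (fun s : R => x + s) 1.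
    by apply: is_derive_eq (is_deriveD (is_derive_cst x t 1) (is_derive_id t 1)) _; rewrite add0r.
  have dl := is_derive1_comp (is_derive1_ln xt0) dx.
  have H := is_deriveD (is_deriveN dl) (is_derive_bernoulli_term 0 xt0).
  rewrite (_ : em_antideriv x 1 = - (@ln R \o (fun s : R => x + s)) +
    (fun s => 1%:R^-1 * ((B 1).[s] * (x + s) ^- 1))).
    apply: is_derive_eq H _.
    by rewrite bernoulli_poly0 hornerC !mul1r mulr1 expr1 addrA addNr add0r.
  by apply/funext => s; rewrite /em_antideriv big_geq// addr0 !fctE invr1 expr1 mul1r.
have H := is_deriveD (is_derive_bernoulli_term m.*2.+1 xt0)
  (is_derive_bernoulli_term m.*2.+2 xt0).
rewrite (_ : em_antideriv x m.+2 = em_antideriv x m.+1 +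
  ((fun s => (m.*2.+2)%:R^-1 * ((B m.*2.+2).[s] * (x + s) ^- m.*2.+2)) +
  (fun s => (m.*2.+3)%:R^-1 * ((B m.*2.+3).[s] * (x + s) ^- m.*2.+3)))).
  by apply: is_derive_eq (is_deriveD IH H) _; rewrite doubleS; ring.
by apply/funext => s; rewrite /em_antideriv big_nat_recr//= doubleS !addrA.
Qed.

(** The Euler-Maclaurin remainder of 1/x on [x, x + 1] is the increment of [G] over [0, 1], hence a
    value of the derivative of [G] inside (0, 1). *)
Lemma euler_maclaurin_inv_sign x n : 0 < x ->
  0 < (-1) ^+ n * (2^-1 * (x^-1 + (x + 1)^-1) - (ln (x + 1) - ln x)
    - \sum_(1 <= k < n.+1) b k.*2 / k.*2%:R * (x ^- k.*2 - (x + 1) ^- k.*2)).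
Proof.
move=> x0.
pose c : R := (n.+1.*2)%:R^-1.
(* The added terms cancel at t = 0 and t = 1, where B_(2n+2) equals b_(2n+2). In the derivative they
   replace B_(2n+1), which changes sign at 1/2, by B_(2n+2) - b_(2n+2), which has one sign on (0,
   1). *)
pose G t := em_antideriv x n.+1 t +
  (c * ((B n.+1.*2).[t] * (x + t) ^- n.+1.*2) - (c * b n.+1.*2) * (x + t) ^- n.+1.*2).
have dG t : 0 <= t -> is_derive t 1 G
    (- (((B n.+1.*2).[t] - b n.+1.*2) * (x + t) ^- n.+1.*2.+1)).
  move=> t0; have xt0 : 0 < x + t by rewrite ltr_wpDr.
  have H := is_deriveB (is_derive_bernoulli_term n.*2.+1 xt0)
     (is_deriveZ (c * b n.+1.*2) (is_derive_expVn n.+1.*2 xt0)).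
  have H2 := is_deriveD (is_derive_em_antideriv n xt0) H.
  apply: is_derive_eq H2 _.
  rewrite doubleS addrA addrA addNr add0r /GRing.scale/=.
  have nn : n.*2.+2%:R != 0 :> R by rewrite pnatr_eq0.
  rewrite /c doubleS.
  move: (n.*2.+2%:R : R) nn ((x + t) ^+ n.*2.+3) (expf_neq0 n.*2.+3 (lt0r_neq0 xt0)) => N N0 u u0.
  by field; rewrite N0 u0.
have [||c1 /andP[c10 c11]] := @mvt_is_derive R G
    (fun t => - (((B n.+1.*2).[t] - b n.+1.*2) * (x + t) ^- n.+1.*2.+1)) 0 1.
- exact: ltr01.
- by move=> t /andP[t0 _]; exact: dG.
rewrite subr0 mulr1 => GE.
have B01 k : (0 < k)%N -> (B k.*2).[1] = b k.*2 /\ (B k.*2.+1).[1] = 0.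
  case: k => // k _; split.
    by have := bernoulli_poly_diff01 R k.*2.+1; rewrite -doubleS => /subr0_eq.
  have := bernoulli_poly_diff01 R k.*2.+2.
  by rewrite -doubleS bernoulli_poly_odd// subr0 => ->.
have GE2 : G 1 - G 0 = 2^-1 * (x^-1 + (x + 1)^-1) - (ln (x + 1) - ln x)
    - \sum_(1 <= k < n.+1) b k.*2 / k.*2%:R * (x ^- k.*2 - (x + 1) ^- k.*2).
  have cancel (u s : R) : u = b n.+1.*2 -> c * (u * s) - c * b n.+1.*2 * s = 0.
    by move=> ->; ring.
  rewrite /G !cancel ?(B01 n.+1 _).1// !addr0 /em_antideriv addr0 bernoulli_poly1.
  rewrite !hornerD !hornerN !hornerC !hornerX opprD addrACA -sumrB.
  rewrite -sumrN; congr (_ + _); last first.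
    rewrite !big_nat; apply: eq_bigr => k /andP[k0 _].
    have [-> ->] := B01 k k0; rewrite bernoulli_poly_odd// !mul0r !mulr0 !addr0.
    by rewrite -/(b k.*2); ring.
  by field; rewrite !gt_eqF// addr_gt0.
rewrite -GE2 GE mulrN -mulrN1 mulrC mulrA mulrA -exprS pmulr_lgt0.
  by apply: bernoulli_poly_even_sign; rewrite c10.
by rewrite invr_gt0 exprn_gt0// addr_gt0.
Qed.

(** Monotone convergence gives only [0 <= w n.+1]; the strict step [w n.+1 < w n] does the rest. *)
Lemma decreasing_cvg0_gt0 (w : nat -> R) : (forall n, w n.+1 < w n) ->
  (w @ \oo --> 0)%classic -> forall n, 0 < w n.
Proof.
move=> wS w0 n; apply: le_lt_trans (wS n).
have wdec : nonincreasing_seq w by apply/nonincreasing_seqP => k; exact: ltW.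
rewrite -(cvg_lim _ w0)//; apply: nonincreasing_cvgn_ge => //.
by apply/cvg_ex; exists 0.
Qed.

Lemma cvg_expVn k : ((fun n => n.+1%:R ^- k.+1 : R) @ \oo --> 0)%classic.
Proof.
elim: k => [|k IH].
  by rewrite (_ : (fun _ => _) = harmonic)//; exact: cvg_harmonic.
rewrite (_ : (fun _ => _) = (fun n => n.+1%:R ^- k.+1 : R) \* harmonic).
  by rewrite -(mulr0 0); apply: cvgM => //; exact: cvg_harmonic.
by apply/funext => n /=; rewrite exprSr invfM.
Qed.

Local Notation H := (harmonic_number R).

(** The Euler-Mascheroni constant: the subtracted half term tends to 0, and it turns the increments
    into trapezoidal errors of 1/x, which makes the sequence monotone. *)
Definition euler_gamma : R :=
  limn (fun n => H n.+1 - ln n.+1%:R - (2 * n.+1%:R)^-1).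

Definition harmonic_error n : R :=
  ln n%:R + euler_gamma + (2 * n%:R)^-1 - H n.

(** The bound on [k] is exclusive, so [harmonic_series m.+1] has m terms and [harmonic_series 1] is
    empty. *)
Definition harmonic_series m n : R :=
  \sum_(1 <= k < m) b k.*2 / k.*2%:R * n%:R ^- k.*2.

Lemma cvg_harmonic_series m : ((fun n => harmonic_series m n.+1) @ \oo --> 0)%classic.
Proof.
elim: m => [|[|m] IH]; rewrite /harmonic_series.
- by under eq_fun do rewrite big_geq//; exact: cvg_cst.
- by under eq_fun do rewrite big_geq//; exact: cvg_cst.
under eq_fun do rewrite big_nat_recr//=.
have := cvgD IH (cvgMl_tmp (a := b m.+1.*2 / m.+1.*2%:R) (cvg_expVn m.*2.+1)).
by rewrite mulr0 addr0 => h; exact: h.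
Qed.

Lemma harmonic_numberS n : H n.+1 = H n + n.+1%:R^-1.
Proof. by rewrite /harmonic_number big_nat_recr//= mul1r. Qed.

(** The increment of [u] is the trapezoidal error of 1/x on [n + 1, n + 2], to which
    [euler_maclaurin_inv_sign] applies. *)
Lemma euler_maclaurin_harmonic_step m n :
  let u n := H n.+1 - ln n.+1%:R - (2 * n.+1%:R)^-1 in
  0 < (-1) ^+ m * ((u n.+1 + harmonic_series m.+1 n.+2) -
                   (u n + harmonic_series m.+1 n.+1)).
Proof.
have := euler_maclaurin_inv_sign m (ltr0Sn R n); congr (0 < _ * _).
rewrite natr1 harmonic_numberS /harmonic_series.
have -> : \sum_(1 <= k < m.+1) b k.*2 / k.*2%:R * (n.+1%:R ^- k.*2 - n.+2%:R ^- k.*2) =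
  \sum_(1 <= k < m.+1) b k.*2 / k.*2%:R * n.+1%:R ^- k.*2 -
  \sum_(1 <= k < m.+1) b k.*2 / k.*2%:R * n.+2%:R ^- k.*2.
  by rewrite -sumrB; apply: eq_bigr => k _; rewrite mulrBr.
have : n.+1%:R != 0 :> R by []. 
have : n.+2%:R != 0 :> R by [].
move: (n.+1%:R : R) (n.+2%:R : R) => x y y0 x0.
by field; rewrite x0 y0.
Qed.

(** Order 0 makes [u] nondecreasing; order 1 makes [u] plus a bounded correction nonincreasing,
    which bounds [u] above. *)
Lemma is_cvg_euler_gamma :
  cvgn (fun n => H n.+1 - ln n.+1%:R - (2 * n.+1%:R)^-1).
Proof.
set u := (fun n => _); pose w n := u n + harmonic_series 2 n.+1.
have uS n : u n <= u n.+1.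
  have /= := euler_maclaurin_harmonic_step 0 n.
  rewrite /harmonic_series !big_geq// !addr0 expr0 mul1r -/(u _) -/(u n).
  by rewrite subr_gt0 => /ltW.
have wS n : w n.+1 <= w n.
  have /= := euler_maclaurin_harmonic_step 1 n.
  by rewrite ?expr1 mulN1r oppr_gt0 subr_lt0 => /ltW.
apply: nondecreasing_is_cvgn; first exact/nondecreasing_seqP.
exists (w 0 + `|b 2|) => _ [n _ <-].
have wn : w n <= w 0 by apply: (nonincreasing_seqP _).1.
have : - `|b 2| <= harmonic_series 2 n.+1.
  rewrite /harmonic_series big_nat1 /=.
  rewrite lerNl; apply: le_trans (ler_norm _) _; rewrite normrN -mulrA normrM.
  rewrite ler_piMr// ger0_norm ?mulr_ge0// ?invr_ge0 ?exprn_ge0//.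
  by rewrite mulr_ile1 ?invr_ge0 ?exprn_ge0// invf_le1 ?exprn_gt0// ?exprn_ege1 ?ler1n.
by move: wn; rewrite /w; lra.
Qed.

(** The signed difference decreases strictly in n, by the Euler-Maclaurin step, and tends to 0. *)
Lemma harmonic_error_sign m n : (0 < n)%N ->
  0 < (-1) ^+ m * (harmonic_error n - harmonic_series m.+1 n).
Proof.
case: n => // n _; pose w n := (-1) ^+ m * (harmonic_error n.+1 - harmonic_series m.+1 n.+1).
apply: (@decreasing_cvg0_gt0 w) => [k|].
  rewrite -subr_gt0 /w -mulrBr.
  have := euler_maclaurin_harmonic_step m k; congr (0 < _ * _).
  by rewrite /harmonic_error; ring.
rewrite -(mulr0 ((-1) ^+ m)); apply: cvgMl_tmp.
rewrite -(subr0 0); apply: cvgB; last exact: cvg_harmonic_series.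
rewrite -(subrr euler_gamma).
rewrite (_ : (fun k => _) = (fun k => euler_gamma - (H k.+1 - ln k.+1%:R - (2 * k.+1%:R)^-1))).
  by apply: cvgB; [exact: cvg_cst|exact: is_cvg_euler_gamma].
by apply/funext => k; rewrite /harmonic_error; ring.
Qed.

End EulerMaclaurin.

(** * Stirling's formula *)

Section Stirling.
Variable R : realType.
Implicit Types (n k : nat) (x t : R).

Local Notation mu := (@lebesgue_measure R).

(** * Wallis integrals and Wallis's product *)

Definition sin_integral n : R := \int[mu]_(x in `[0, pi / 2]) sin x ^+ n.

Local Notation I := `[0, pi / 2 : R]%classic.

Lemma continuous_sinX n : continuous (fun x : R => sin x ^+ n).
Proof.
by move=> x; apply: (@continuous_comp _ _ _ (@sin R) (@GRing.exp R ^~ n));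
  [exact: continuous_sin|exact: exprn_continuous].
Qed.

Lemma integrable_sinX n : mu.-integrable I (EFin \o (fun x : R => sin x ^+ n)).
Proof.
apply: continuous_compact_integrable; first exact: segment_compact.
by apply: continuous_subspaceT; exact: continuous_sinX.
Qed.

Lemma Rintegral_is_derive (F f : R -> R) (a c : R) : a < c -> continuous f ->
  (forall x, is_derive x 1 F (f x)) ->
  \int[mu]_(x in `[a, c]) f x = F c - F a.
Proof.
move=> ac cf dF.
have cF : continuous F.
  by move=> x; apply/differentiable_continuous/derivable1_diffP; apply: ex_derive.
have /= := @continuous_FTC2 R f F a c ac (continuous_subspaceT cf).
rewrite /Rintegral => -> //.
  split; first by move=> x _; apply: ex_derive.
  - exact/cvg_at_right_filter/cF.
  - exact/cvg_at_left_filter/cF.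
by move=> x _; rewrite derive1E; apply: derive_val.
Qed.

Lemma pihalf_gt0 : 0 < pi / 2 :> R.
Proof. by rewrite divr_gt0// pi_gt0. Qed.

Lemma sin_integral0 : sin_integral 0 = pi / 2.
Proof.
have := @Rintegral_is_derive id _ _ _ pihalf_gt0 (@continuous_sinX 0).
by rewrite subr0; apply => x; exact: is_derive_id.
Qed.

Lemma sin_integral1 : sin_integral 1 = 1.
Proof.
have := @Rintegral_is_derive (- @cos R) _ _ _ pihalf_gt0 (@continuous_sinX 1).
rewrite !fctE cos_pihalf cos0 opprK oppr0 add0r; apply => x.
by apply: is_derive_eq (is_deriveN (is_derive_cos x)) _; rewrite opprK expr1.
Qed.

(** Integration by parts in disguise: [F] vanishes at both endpoints, and its derivative is the
    difference of the two integrands. *)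
Lemma sin_integralS n :
  n.+2%:R * sin_integral n.+2 = n.+1%:R * sin_integral n.
Proof.
apply/eqP; rewrite -subr_eq0; apply/eqP.
rewrite /sin_integral -!RintegralZl//; [|exact: integrable_sinX..].
rewrite -RintegralB//; last first.
  by apply: (integrableZl _ n.+1%:R (integrable_sinX n)).
  by apply: (integrableZl _ n.+2%:R (integrable_sinX n.+2)).
pose F x : R := - cos x * sin x ^+ n.+1.
have := @Rintegral_is_derive F
  (fun x => n.+2%:R * sin x ^+ n.+2 - n.+1%:R * sin x ^+ n) _ _ pihalf_gt0.
rewrite /F cos_pihalf sin0 expr0n/= oppr0 mul0r mulr0 subr0 -/F; apply.
  by move=> x; apply: cvgB; apply: cvgMl_tmp; exact: continuous_sinX.
move=> x; have H := is_deriveM (is_deriveN (is_derive_cos x)) (is_deriveX n.+1 (is_derive_sin x)).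
rewrite (_ : F = (- @cos R) * (@sin R ^+ n.+1)); last first.
  by apply/funext => y; rewrite /F !fctE.
apply: is_derive_eq H _; rewrite /GRing.scale/= !fctE opprK.
have -> : - cos x * (n.+1%:R * sin x ^+ n * cos x) = - (n.+1%:R * (cos x ^+ 2 * sin x ^+ n)).
  by ring.
by rewrite cos2sin2 mulrBl mul1r -exprD add2n exprSr -[n.+2%:R]natr1; ring.
Qed.

Lemma sin_integral_le n : sin_integral n.+1 <= sin_integral n.
Proof.
apply: le_Rintegral => //; [exact: integrable_sinX..|] => x /=.
rewrite in_itv/= => /andP[x0 xp].
have s0 : 0 <= sin x.
  by rewrite sin_ge0_pi// x0 (le_trans xp)// ler_pdivrMr// ler_peMr ?pi_ge0// ler1n.
by rewrite exprS ler_piMl ?exprn_ge0// sin_le1.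
Qed.

(** This is 4^n divided by the central binomial coefficient, equivalently the product of 2k / (2k -
    1) for 1 <= k <= n. *)
Definition wallis n : R := 4 ^+ n * n`!%:R ^+ 2 / (n.*2)`!%:R.

Lemma wallis_gt0 n : 0 < wallis n.
Proof. by rewrite divr_gt0 ?ltr0n ?fact_gt0// mulr_gt0 ?exprn_gt0 ?ltr0n ?fact_gt0. Qed.

Lemma wallisS n : wallis n.+1 = (n.*2.+2)%:R / (n.*2.+1)%:R * wallis n.
Proof.
rewrite /wallis doubleS !factS !natrM exprS.
have f0 : (n.*2)`!%:R != 0 :> R by rewrite pnatr_eq0 -lt0n fact_gt0.
have -> : n.*2.+2%:R = 2 * n.+1%:R :> R by rewrite -natrM mul2n.
have n0 : n.+1%:R != 0 :> R by [].
have m0 : n.*2.+1%:R != 0 :> R by [].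
move: (n.+1%:R : R) (n.*2.+1%:R : R) ((n.*2)`!%:R : R) n0 m0 f0 => x y z x0 y0 z0.
by field; rewrite x0 y0 z0.
Qed.

Lemma sin_integral_even n : sin_integral n.*2 = pi / 2 / wallis n.
Proof.
elim: n => [|n IH]; first by rewrite sin_integral0 /wallis expr0 fact0 expr1n mul1r !divr1.
have := sin_integralS n.*2; rewrite -doubleS IH wallisS => E.
have n0 : n.*2.+2%:R != 0 :> R by [].
have m0 : n.*2.+1%:R != 0 :> R by [].
apply: (mulfI n0); rewrite E.
have w0 := lt0r_neq0 (wallis_gt0 n).
by move: (n.*2.+2%:R : R) (n.*2.+1%:R : R) n0 m0 => x y x0 y0; field; rewrite w0 x0 y0.
Qed.

Lemma sin_integral_odd n : sin_integral n.*2.+1 = wallis n / n.*2.+1%:R.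
Proof.
elim: n => [|n IH]; first by rewrite sin_integral1 /wallis expr0 fact0 expr1n mul1r !divr1.
have := sin_integralS n.*2.+1; rewrite -doubleS IH wallisS => E.
have n0 : n.*2.+2%:R != 0 :> R by [].
have m0 : n.*2.+1%:R != 0 :> R by [].
have k0 : n.*2.+3%:R != 0 :> R by [].
apply: (mulfI k0); rewrite E doubleS.
move: (n.*2.+2%:R : R) (n.*2.+1%:R : R) (n.*2.+3%:R : R) n0 m0 k0 => x y z x0 y0 z0.
by field; rewrite ?x0 ?y0 ?z0.
Qed.

(** The integrals of indices 2n + 2, 2n + 1 and 2n increase in this order, and each is explicit in
    [wallis n]. *)
Lemma wallis_bounds n : pi / 2 * n.*2.+1%:R ^+ 2 / n.*2.+2%:R <= wallis n ^+ 2
  <= pi / 2 * n.*2.+1%:R.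
Proof.
have := sin_integral_le n.*2; have := sin_integral_le n.*2.+1.
rewrite -doubleS !sin_integral_even sin_integral_odd wallisS.
have := wallis_gt0 n; move: (wallis n) => w w0.
have : 0 < n.*2.+2%:R :> R by [].
have : 0 < n.*2.+1%:R :> R by [].
move: (n.*2.+1%:R : R) (n.*2.+2%:R : R) (pi / 2 : R) => x y p x0 y0.
rewrite ler_pdivrMr; last by rewrite mulr_gt0// divr_gt0.
move=> H1 H2.
apply/andP; split; last by move: H2; rewrite ler_pdivrMr// mulrAC ler_pdivlMr// -expr2.
have E : w / x * (y / x * w) = w ^+ 2 * y / x ^+ 2 by field; rewrite gt_eqF.
by move: H1; rewrite E ler_pdivlMr ?exprn_gt0// ler_pdivrMr.
Qed.

Lemma cvg_wallis : ((fun n => wallis n.+1 ^+ 2 / n.+1%:R) @ \oo --> pi)%classic.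
Proof.
have lim (a : R) : ((fun n => pi + a * harmonic n : R) @ \oo --> pi)%classic.
  have := cvgD (cvg_cst (pi : R)) (cvgMl_tmp (a := a) (@cvg_harmonic R)).
  by rewrite mulr0 addr0 => h; exact: h.
apply: (squeeze_cvgr _ (lim (- pi)) (lim pi)); near=> n.
have /andP[lo hi] := wallis_bounds n.+1; move: lo hi.
have -> : n.+1.*2.+1%:R = 2 * n.+1%:R + 1 :> R by rewrite -natr1 -mul2n natrM.
have -> : n.+1.*2.+2%:R = 2 * n.+1%:R + 2 :> R by rewrite -addn2 natrD -mul2n natrM.
rewrite /harmonic /=; have := @pi_gt0 R.
have : 0 < n.+1%:R :> R by [].
move: (n.+1%:R : R) (wallis n.+1 ^+ 2) (pi : R) => x w p x0 p0.
rewrite ler_pdivrMr; last by lra.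
rewrite ler_pdivlMr// ler_pdivrMr// => lo hi.
have -> : (p + - p / x) * x = p * x - p by field; rewrite gt_eqF.
have -> : (p + p / x) * x = p * x + p by field; rewrite gt_eqF.
apply/andP; split; last by lra.
(* The lower bound reduces to [(2 x + 1)^2 >= 2 x (2 x + 2)]. *)
have : p * x <= w; last by lra.
rewrite -(ler_pM2r (_ : 0 < 2 * x + 2)); last by lra.
by apply: le_trans lo; rewrite expr2; lra.
Unshelve. all: by end_near.
Qed.

(** * Convergence of Stirling's approximation *)

(** The logarithm of n! / (n^(n + 1/2) e^(-n)). *)
Definition stirling_error n : R :=
  ln n`!%:R - (n%:R + 2^-1) * ln n%:R + n%:R.

(** The left side is 2t / (2 + t), the bound that makes the lower estimate in [stirling_error_step]
    exactly 0. The difference of the sides has derivative s^2 / ((1 + s) (2 + s)^2). *)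
Lemma ln1D_ge t : 0 <= t -> 2 - 4 * (2 + t)^-1 <= ln (1 + t).
Proof.
rewrite le_eqVlt => /predU1P[<-|t0]; first by rewrite !addr0 ln1; lra.
have d (s : R) : 0 <= s -> is_derive s 1
    ((@ln R \o (fun s : R => 1 + s)) + 4 \*: (fun s : R => (2 + s) ^- 1))
    (s ^+ 2 / ((1 + s) * (2 + s) ^+ 2)).
  move=> s0; have s1 : 0 < 1 + s by rewrite ltr_wpDr.
  have s2 : 0 < 2 + s by rewrite ltr_wpDr.
  have ds : is_derive s 1 (fun s : R => 1 + s) 1.
    by apply: is_derive_eq (is_deriveD (is_derive_cst (1 : R) s 1) (is_derive_id s 1)) _; rewrite add0r.
  have H := is_deriveD (is_derive1_comp (is_derive1_ln s1) ds) (is_deriveZ 4 (is_derive_expVn 1 s2)).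
  apply: is_derive_eq H _; rewrite /GRing.scale/=.
  by field; rewrite !gt_eqF.
have [c /andP[c0 ct]] := @mvt_is_derive R _ _ 0 t t0 (fun s H => d s (andP H).1).
rewrite !fctE /= !addr0 ln1 expr1 subr0 => E.
suff : 0 <= c ^+ 2 / ((1 + c) * (2 + c) ^+ 2) * t by rewrite -E /GRing.scale/= expr1; lra.
apply: mulr_ge0; last exact: ltW.
by rewrite divr_ge0 ?sqr_ge0// mulr_ge0 ?sqr_ge0// addr_ge0// ltW.
Qed.

(** With x = n + 1 the difference is (x + 1/2) (ln (x + 1) - ln x) - 1. The trapezoidal bound on the
    logarithm makes it at most 1 / (4 x (x + 1)), which telescopes. *)
Lemma stirling_error_step n :
  0 <= stirling_error n.+1 - stirling_error n.+2 <= 4^-1 * (n.+1%:R^-1 - n.+2%:R^-1).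
Proof.
have x0 : 0 < n.+1%:R :> R by [].
have := euler_maclaurin_inv_sign 0 x0.
rewrite big_geq// subr0 expr0 mul1r subr_gt0.
have := ln1D_ge (ltW (_ : 0 < n.+1%:R^-1)); rewrite invr_gt0 x0 => /(_ isT).
have -> : 1 + n.+1%:R^-1 = (n.+1%:R + 1) / n.+1%:R :> R by field.
rewrite ln_div ?posrE ?addr_gt0// /stirling_error [n.+2`!]factS natrM.
rewrite lnM ?posrE// ?ltr0n ?fact_gt0// -[n.+2%:R]natr1.
move: (ln n.+1`!%:R) (n.+1%:R : R) x0 => f x x0.
move: (ln x) (ln (x + 1)) => l l' lo hi.
have -> : f - (x + 2^-1) * l + x - (l' + f - (x + 1 + 2^-1) * l' + (x + 1)) =
  (x + 2^-1) * (l' - l) - 1 by field.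
have xh : 0 < x + 2^-1 by lra.
apply/andP; split.
  apply: le_trans (_ : (x + 2^-1) * (2 - 4 * (2 + x^-1)^-1) - 1 <= _).
    by rewrite le_eqVlt; apply/orP; left; apply/eqP; field; rewrite !gt_eqF//; lra.
  by rewrite lerD2r ler_pM2l.
apply: le_trans (_ : (x + 2^-1) * (2^-1 * (x^-1 + (x + 1)^-1)) - 1 <= _).
  by rewrite lerD2r ler_pM2l// ltW.
by rewrite le_eqVlt; apply/orP; left; apply/eqP; field; rewrite !gt_eqF//; lra.
Qed.

(** The two bounds on a step say that [stirling_error n] and [stirling_error n - 1 / (4 n)] are
    adjacent sequences. *)
Lemma is_cvg_stirling_error : cvgn (fun n => stirling_error n.+1).
Proof.
have nd : nondecreasing_seq (fun n => stirling_error n.+1 - 4^-1 * n.+1%:R^-1).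
  apply/nondecreasing_seqP => n /=; have /andP[_] := stirling_error_step n.
  by move: (n.+1%:R^-1) (n.+2%:R^-1) => a c h; lra.
have ni : nonincreasing_seq (fun n => stirling_error n.+1).
  by apply/nonincreasing_seqP => n /=; have /andP[] := stirling_error_step n; lra.
have E : (fun n => stirling_error n.+1) - (fun n => stirling_error n.+1 - 4^-1 * n.+1%:R^-1)
    = (fun n => 4^-1 * harmonic n).
  by apply/funext => n; rewrite !fctE opprB addrC subrK.
have [] // := adjacent_seq nd ni; rewrite E -(mulr0 4^-1).
by apply: cvgMl_tmp; exact: cvg_harmonic.
Qed.

(** The left side has the same limit as [stirling_error], since 2 l - l = l, while its factorials
    form n!^2 / (2n)!; this is how Wallis's product determines the constant. *)
Lemma stirling_error_double n : (0 < n)%N ->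
  2 * stirling_error n - stirling_error n.*2 =
  2^-1 * ln (wallis n ^+ 2 / n%:R) + 2^-1 * ln 2.
Proof.
move=> n0; have nr : 0 < n%:R :> R by rewrite ltr0n.
have f0 k : 0 < k`!%:R :> R by rewrite ltr0n fact_gt0.
rewrite /stirling_error ln_div ?posrE ?exprn_gt0 ?wallis_gt0//.
rewrite lnXn ?wallis_gt0// /wallis ln_div ?posrE ?mulr_gt0 ?exprn_gt0//.
rewrite lnM ?posrE ?exprn_gt0// !lnXn//.
have -> : (4 : R) = 2 ^+ 2 by rewrite expr2; ring.
rewrite lnXn ?ltr0n// -mul2n natrM lnM ?posrE//.
rewrite -[ln 2 *+ 2 *+ n]mulr_natr.
move: (ln n`!%:R) (ln (2 * n)`!%:R) (ln (2 : R)) (ln (n%:R : R)) (n%:R : R).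
by move=> a c d e x; field.
Qed.

Lemma cvg_subseq (u : nat -> R) (l : R) (h : nat -> nat) :
  (forall n, (n <= h n)%N) -> (u @ \oo --> l)%classic -> ((fun n => u (h n)) @ \oo --> l)%classic.
Proof.
move=> nh; apply: cvg_comp => A [N _ NA].
by exists N => // n /= Nn; apply: NA; exact: leq_trans (nh n).
Qed.

Lemma cvg_stirling_error :
  ((fun n => stirling_error n.+1) @ \oo --> 2^-1 * ln (2 * pi))%classic.
Proof.
have /cvg_ex[l sl] := is_cvg_stirling_error.
suff <- : l = 2^-1 * ln (2 * pi) by [].
have s2l : ((fun n => stirling_error n.+1.*2) @ \oo --> l)%classic.
  under eq_fun do rewrite doubleS.
  apply: (@cvg_subseq (fun n => stirling_error n.+1) l (fun n => n.*2.+1)) => // n.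
  by rewrite ltnW// ltnS -addnn leq_addr.
have E : 2 * l - l = 2^-1 * ln pi + 2^-1 * ln 2.
  have h1 := cvgB (cvgMl_tmp (a := 2) sl) s2l.
  have h2 : ((fun n => 2 * stirling_error n.+1 - stirling_error n.+1.*2) @ \oo -->
     2^-1 * ln pi + 2^-1 * ln 2)%classic.
    under eq_fun do rewrite stirling_error_double//.
    apply: cvgD; last exact: cvg_cst.
    apply: cvgMl_tmp; apply: (continuous_cvg _ (continuous_ln (pi_gt0 R))).
    exact: cvg_wallis.
  by rewrite -(cvg_lim (@Rhausdorff R) (h1 _ _)) -(cvg_lim (@Rhausdorff R) h2).
rewrite lnM ?posrE ?pi_gt0//; lra.
Qed.

End Stirling.

(** * Partial fractions of the cotangent *)

Section CotangentExpansion.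
Variable R : realType.
Implicit Types (x y t u : R) (n k N r : nat).

(** Used to climb from [sin t <= t] to the quadratic bound on cos and the cubic bound on sin: each
    is the derivative of the next. *)
Lemma is_derive_ge0_ge0 (f df : R -> R) t : 0 <= t -> f 0 = 0 ->
  (forall s, 0 <= s <= t -> is_derive s 1 f (df s)) ->
  (forall s, 0 <= s <= t -> 0 <= df s) -> 0 <= f t.
Proof.
rewrite le_eqVlt => /predU1P[<- -> //|t0] f0 fE df0.
have [c /andP[c0 ct]] := mvt_is_derive t0 fE.
by rewrite f0 !subr0 => ->; rewrite mulr_ge0 ?df0 ?ltW.
Qed.

Lemma sin_le_id t : 0 <= t -> sin t <= t.
Proof.
move=> t0; pose f := id - @sin R; have f0 : f 0 = 0 by rewrite /f !fctE sin0 subr0.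
have df (s : R) : is_derive s 1 f (1 - cos s) by exact: is_deriveB.
rewrite -subr_ge0; apply: (is_derive_ge0_ge0 t0 f0 (fun s _ => df s)) => s _.
by rewrite subr_ge0 cos_le1.
Qed.

Lemma cos_ge t : 0 <= t -> 1 - 2^-1 * t ^+ 2 <= cos t.
Proof.
move=> t0; pose f := @cos R + (2^-1 \*: (id ^+ 2 : R -> R) - cst 1).
have fE s : f s = cos s + (2^-1 * s ^+ 2 - 1) by [].
have f0 : f 0 = 0 by rewrite fE cos0 expr0n /=; lra.
have df (s : R) : is_derive s 1 f (- sin s + s).
  apply: is_derive_eq (is_deriveD (is_derive_cos s) (is_deriveB
    (is_deriveZ 2^-1 (is_deriveX 2 (is_derive_id s 1))) (is_derive_cst (1 : R) s 1))) _.
  by rewrite /GRing.scale/= expr1; lra.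
suff : 0 <= f t by rewrite fE; lra.
apply: (is_derive_ge0_ge0 t0 f0 (fun s _ => df s)) => s /andP[s0 _].
by have := sin_le_id s0; lra.
Qed.

Lemma sin_ge t : 0 <= t -> t - 6^-1 * t ^+ 3 <= sin t.
Proof.
move=> t0; pose f := @sin R + (6^-1 \*: (id ^+ 3 : R -> R) - id).
have fE s : f s = sin s + (6^-1 * s ^+ 3 - s) by [].
have f0 : f 0 = 0 by rewrite fE sin0 expr0n /=; lra.
have df (s : R) : is_derive s 1 f (cos s + (2^-1 * s ^+ 2 - 1)).
  apply: is_derive_eq (is_deriveD (is_derive_sin s) (is_deriveB
    (is_deriveZ 6^-1 (is_deriveX 3 (is_derive_id s 1))) (is_derive_id s 1))) _.
  by rewrite /GRing.scale/=; lra.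
suff : 0 <= f t by rewrite fE; lra.
apply: (is_derive_ge0_ge0 t0 f0 (fun s _ => df s)) => s /andP[s0 _].
by have := cos_ge s0; lra.
Qed.

(** The numerator (u - sin u) (u + sin u) is at most (u^3 / 6) (2 u). As u < 2, the cubic bound
    gives sin u >= u / 3, so the denominator is at least u^4 / 9; the quotient yields 3. *)
Lemma sinV2_bounds u : 0 < u < 2 -> 0 <= sin u ^- 2 - u ^- 2 <= 3.
Proof.
move=> /andP[u0 u2]; have s1 := sin_le_id (ltW u0); have s3 := sin_ge (ltW u0).
have uu : u ^+ 2 <= 4.
  have -> : (4 : R) = 2 ^+ 2 by rewrite expr2; ring.
  by rewrite ler_pXn2r ?nnegrE ?ltW.
have s13 : u / 3 <= sin u.
  apply: le_trans s3; rewrite exprS.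
  suff : u * u ^+ 2 <= u * 4 by lra.
  by rewrite ler_pM2l.
have s0 : 0 < sin u by apply: lt_le_trans s13; rewrite divr_gt0.
have E : sin u ^- 2 - u ^- 2 = (u ^+ 2 - sin u ^+ 2) / (u ^+ 2 * sin u ^+ 2).
  by field; rewrite !gt_eqF.
have d0 : 0 < u ^+ 2 * sin u ^+ 2 by rewrite mulr_gt0 ?exprn_gt0.
have ss : sin u ^+ 2 <= u ^+ 2 by rewrite ler_pXn2r// nnegrE ltW.
rewrite E divr_ge0 ?subr_ge0 ?(ltW d0)//= ler_pdivrMr//.
have -> : u ^+ 2 - sin u ^+ 2 = (u - sin u) * (u + sin u) by ring.
apply: (@le_trans _ _ ((6^-1 * u ^+ 3) * (2 * u))).
  by apply: ler_pM; lra.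
have -> : 6^-1 * u ^+ 3 * (2 * u) = 3 * (u ^+ 2 * (u / 3) ^+ 2) by field.
by rewrite ler_pM2l// ler_pM2l ?exprn_gt0// ler_pXn2r// nnegrE ltW// divr_gt0.
Qed.

(* The terms are 1 / (x + n) for -N <= n < N: with this asymmetric range
   [pole_sum_half] is exact and needs no limit. *)
Definition pole_sum N x : R := \sum_(0 <= k < N.*2) (x + k%:R - N%:R)^-1.

Lemma sum_nat_double (f : nat -> R) n :
  \sum_(0 <= k < n.*2) f k = \sum_(0 <= k < n) (f k.*2 + f k.*2.+1).
Proof.
elim: n => [|n IH]; first by rewrite !big_geq.
by rewrite doubleS !big_nat_recr//= IH addrA.
Qed.

(** After factoring out 1/2, the two sums on the left carry the even and the odd shifts of the sum
    on the right. *)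
Lemma pole_sum_half N x :
  pole_sum N (x / 2) + pole_sum N ((x + 1) / 2) = 2 * pole_sum N.*2 x.
Proof.
rewrite /pole_sum [in RHS]sum_nat_double -big_split/= mulr_sumr; apply: eq_bigr => k _.
rewrite mulrDr -[k.*2.+1%:R]natr1 -!mul2n !natrM.
congr (_ + _); rewrite -[2 in RHS]invrK -invfM; congr (_^-1); by field.
Qed.

(** The range -N <= n < N is invariant under n |-> -1 - n. *)
Lemma pole_sum_onem N x : pole_sum N (1 - x) = - pole_sum N x.
Proof.
rewrite /pole_sum big_nat_rev/= -sumrN !big_nat; apply: eq_bigr => k /andP[_ kN].
rewrite add0n natrB// -natr1 -addnn natrD -invrN; congr (_^-1); ring.
Qed.

Definition cot_remainder N x : R := pi * cot (pi * x) - pole_sum N x.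

(** From cot y + cot (y + pi/2) = 2 cot (2 y), matched with [pole_sum_half]. The doubling of [N] is
    what leads to truncations at powers of two. *)
Lemma cot_remainder_half N x : 0 < x < 1 ->
  cot_remainder N (x / 2) + cot_remainder N ((x + 1) / 2) = 2 * cot_remainder N.*2 x.
Proof.
move=> /andP[x0 x1]; rewrite /cot_remainder addrACA -opprD pole_sum_half mulrBr.
congr (_ - _); rewrite [RHS]mulrCA -mulrDr; congr (_ * _).
have p0 := pi_gt0 R.
set y := pi * (x / 2).
have -> : pi * ((x + 1) / 2) = y + pi / 2 by rewrite /y; field.
have -> : pi * x = y *+ 2 by rewrite /y -mulr_natr; field.
have y0 : 0 < y by rewrite mulr_gt0// divr_gt0.
have yp : y < pi / 2.
  by rewrite /y mulrA ltr_pM2r ?invr_gt0// -[ltRHS]mulr1 ltr_pM2l.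
have s0 : 0 < sin y by rewrite sin_gt0_pihalf ?y0.
have c0 : 0 < cos y by rewrite cos_gt0_pihalf// yp andbT (lt_trans _ y0)// oppr_lt0 divr_gt0.
rewrite /cot cosDpihalf sinDpihalf sin_mulr2n cos_mulr2n.
rewrite [cos y ^+ 2 *+ 2 - 1](_ : _ = cos y ^+ 2 - sin y ^+ 2); last first.
  by rewrite sin2cos2; ring.
by rewrite -mulr_natr; field; rewrite !gt_eqF.
Qed.

Lemma cot_remainder_onem N x : cot_remainder N (1 - x) = - cot_remainder N x.
Proof.
rewrite /cot_remainder pole_sum_onem opprB opprK /cot.
have -> : pi * (1 - x) = - (pi * x) + pi by ring.
by rewrite cosDpi sinDpi cosN sinN opprK; ring.
Qed.

Lemma is_derive_cot_remainder1 x : 0 < x < 1 ->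
  is_derive x 1 (cot_remainder 1)
    (- pi ^+ 2 / sin (pi * x) ^+ 2 + (x - 1) ^- 2 + x ^- 2).
Proof.
move=> /andP[x0 x1].
have p0 := pi_gt0 R.
have s0 : 0 < sin (pi * x).
  by rewrite sin_gt0_pi// mulr_gt0//= -[ltRHS]mulr1 ltr_pM2l.
have dx : is_derive x 1 (fun y : R => pi * y) pi.
  by apply: is_derive_eq (is_deriveZ pi (is_derive_id x 1)) _; rewrite /GRing.scale/= mulr1.
have ds := is_derive1_comp (is_derive_sin (pi * x)) dx.
have dc := is_derive1_comp (is_derive_cos (pi * x)) dx.
have dcot := is_deriveM dc (is_deriveV (f := @sin R \o (fun y : R => pi * y)) (lt0r_neq0 s0) ds).
have dpole (c : R) : x + c != 0 -> is_derive x 1 (fun y : R => (y + c)^-1) (- (x + c) ^- 2).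
  move=> xc; have dxc : is_derive x 1 (fun y : R => y + c) 1.
    by apply: is_derive_eq (is_deriveD (is_derive_id x 1) (is_derive_cst c x 1)) _; rewrite addr0.
  by apply: is_derive_eq (is_deriveV (f := fun y : R => y + c) xc dxc) _; rewrite /GRing.scale/= mulr1.
have n1 : x - 1 != 0 by lra.
have n0 : x + 0 != 0 by lra.
have H := is_deriveB (is_deriveZ pi dcot) (is_deriveD (dpole _ n1) (dpole _ n0)).
rewrite (_ : cot_remainder 1 = pi \*: ((@cos R \o (fun y : R => pi * y)) *
   (fun y => ((@sin R \o (fun y : R => pi * y)) y)^-1)) -
   ((fun y => (y - 1)^-1) + (fun y => (y + 0)^-1))); last first.
  apply/funext => y; rewrite /cot_remainder /pole_sum big_nat_recl//= big_nat1 !fctE.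
  by rewrite !addr0 addrK.
apply: is_derive_eq H _; rewrite /GRing.scale/= addr0.
have -> : pi ^+ 2 = pi ^+ 2 * (cos (pi * x) ^+ 2 + sin (pi * x) ^+ 2) by rewrite cos2Dsin2 mulr1.
by field; rewrite n1 !gt_eqF.
Qed.

Definition cot_lip : R := 3 * pi ^+ 2.

(** The pole at 0 is absorbed by [sinV2_bounds] at u = pi x < 2, at a cost of 3 pi^2; the pole at 1
    is at distance at least 1/2 and contributes at most 4 <= pi^2, of the opposite sign. *)
Lemma cot_remainder1_deriv_bound_half x : 0 < x <= 2^-1 ->
  `|- pi ^+ 2 / sin (pi * x) ^+ 2 + (x - 1) ^- 2 + x ^- 2| <= cot_lip.
Proof.
move=> /andP[x0 x2]; have p2 := pi_ge2 R; have p0 := pi_gt0 R.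
have pp : 4 <= pi ^+ 2 :> R.
  have -> : (4 : R) = 2 ^+ 2 by rewrite expr2; ring.
  by rewrite ler_pXn2r ?nnegrE ?(ltW p0).
have u0 : 0 < pi * x < 2.
  rewrite mulr_gt0//=; apply: le_lt_trans (pihalf_lt2 R).
  by rewrite ler_pM2l.
have /andP[] := sinV2_bounds u0; rewrite exprMn => lo hi.
have q : 0 <= (x - 1) ^- 2 <= 4.
  rewrite invr_ge0 sqr_ge0/= -[4]invrK lef_pV2 ?posrE ?invr_gt0//; last first.
    by rewrite exprn_even_gt0//=; lra.
  have -> : (4^-1 : R) = 2^-1 ^+ 2 by rewrite expr2; field.
  have -> : (x - 1) ^+ 2 = (1 - x) ^+ 2 by ring.
  have h1 : 2^-1 <= 1 - x by clear -x2; lra.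
  by rewrite ler_pXn2r// ?nnegrE ?invr_ge0// (le_trans _ h1) ?invr_ge0.
have E : - pi ^+ 2 / sin (pi * x) ^+ 2 + (x - 1) ^- 2 + x ^- 2 =
   (x - 1) ^- 2 - pi ^+ 2 * (sin (pi * x) ^- 2 - (pi ^+ 2 * x ^+ 2)^-1).
  have -> : x ^- 2 = pi ^+ 2 * (pi ^+ 2 * x ^+ 2)^-1.
    by rewrite [in RHS]invfM mulVKf// expf_neq0// gt_eqF.
  by ring.
have lo' : 0 <= pi ^+ 2 * (sin (pi * x) ^- 2 - (pi ^+ 2 * x ^+ 2)^-1).
  by rewrite mulr_ge0 ?sqr_ge0.
have hi' : pi ^+ 2 * (sin (pi * x) ^- 2 - (pi ^+ 2 * x ^+ 2)^-1) <= 3 * pi ^+ 2.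
  by rewrite mulrC ler_pM2r ?exprn_gt0.
by rewrite E /cot_lip ler_norml; apply/andP; split; lra.
Qed.

Lemma cot_remainder1_deriv_bound x : 0 < x < 1 ->
  `|- pi ^+ 2 / sin (pi * x) ^+ 2 + (x - 1) ^- 2 + x ^- 2| <= cot_lip.
Proof.
move=> /andP[x0 x1]; have [x2|x2] := leP x 2^-1.
  by apply: cot_remainder1_deriv_bound_half; rewrite x0.
have := @cot_remainder1_deriv_bound_half (1 - x).
have -> : pi * (1 - x) = - (pi * x) + pi by ring.
rewrite sinDpi sinN opprK.
have -> : 1 - x - 1 = - x by ring.
have -> : (1 - x) ^+ 2 = (x - 1) ^+ 2 by ring.
by rewrite sqrrN addrAC; apply; lra.
Qed.

Lemma cot_remainder1_lipschitz x y : 0 < x < 1 -> 0 < y < 1 ->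
  `|cot_remainder 1 x - cot_remainder 1 y| <= cot_lip * `|x - y|.
Proof.
wlog xy : x y / x < y.
  move=> H x01 y01; have [/H|/H|->] := ltgtP x y; first exact.
    by rewrite distrC (distrC x); exact.
  by rewrite !subrr !normr0 mulr0.
move=> /andP[x0 x1] /andP[y0 y1].
have [|c /andP[xc cy] E] := mvt_is_derive xy (f := cot_remainder 1)
    (df := fun x => - pi ^+ 2 / sin (pi * x) ^+ 2 + (x - 1) ^- 2 + x ^- 2).
  by move=> t /andP[xt ty]; apply: is_derive_cot_remainder1; lra.
rewrite distrC E (distrC x) normrM ler_wpM2r//.
by apply: cot_remainder1_deriv_bound; lra.
Qed.

(* Averaging over the two preimages of [x] under doubling halves the Lipschitz
   constant. *)
Lemma cot_remainder_lipschitz r x y : 0 < x < 1 -> 0 < y < 1 ->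
  `|cot_remainder (2 ^ r) x - cot_remainder (2 ^ r) y| <= cot_lip / 2 ^+ r * `|x - y|.
Proof.
elim: r x y => [|r IH] x y x01 y01.
  by rewrite expn0 expr0 divr1; exact: cot_remainder1_lipschitz.
rewrite expnS mul2n -(ler_pM2l (ltr0Sn R 1)) -{1}(ger0_norm (ler0n R 2)) -normrM mulrBr.
rewrite -!cot_remainder_half// opprD addrACA; apply: le_trans (ler_normD _ _) _.
have h1 : `|x / 2 - y / 2| = `|x - y| / 2 by rewrite -mulrBl normrM (ger0_norm (_ : 0 <= 2^-1)).
have h2 : `|(x + 1) / 2 - (y + 1) / 2| = `|x - y| / 2.
  by rewrite -h1; congr (`|_|); field.
apply: le_trans (lerD (IH (x / 2) (y / 2) _ _) (IH ((x + 1) / 2) ((y + 1) / 2) _ _)) _; [lra..|].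
rewrite h1 h2 le_eqVlt; apply/orP; left; apply/eqP.
rewrite exprS; field; rewrite expf_neq0//.
Qed.

(** The remainder is odd about 1/2, so it vanishes there, and its Lipschitz constant is
    [cot_lip / 2 ^+ r]. *)
Lemma cot_expansion r x : 0 < x < 1 ->
  `|pi * cot (pi * x) - pole_sum (2 ^ r) x| <= cot_lip / 2 ^+ r.
Proof.
move=> x01; have h : 0 < (2^-1 : R) < 1 by apply/andP; split; lra.
have c0 : cot_remainder (2 ^ r) 2^-1 = 0.
  have := cot_remainder_onem (2 ^ r) 2^-1.
  have -> : 1 - 2^-1 = 2^-1 :> R by lra.
  lra.
have := cot_remainder_lipschitz r x01 h; rewrite c0 subr0 => /le_trans; apply.
rewrite ler_piMr//; last by rewrite ler_norml; lra.
by rewrite divr_ge0 ?exprn_ge0// mulr_ge0 ?sqr_ge0.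
Qed.

End CotangentExpansion.

(** * The cotangent sum *)

Section CotangentSum.
Variable R : realType.
Implicit Types (p m n k j N r : nat) (x y : R).
Local Notation b := (bernoulli_number R).
Local Notation H := (harmonic_number R).
Local Notation J := (cot_sum R).
Local Notation g := (harmonic_error R).
Local Notation gamma := (euler_gamma R).

Lemma cvg_sum_nat (a c : nat) (F : nat -> nat -> R) (l : nat -> R) :
  (forall j, (a <= j < c)%N -> (F j @ \oo --> l j)%classic) ->
  ((fun n => \sum_(a <= j < c) F j n) @ \oo --> \sum_(a <= j < c) l j)%classic.
Proof.
move=> Fl; under eq_fun do rewrite big_nat; rewrite big_nat.
by apply: cvg_big => //; exact: add_continuous.
Qed.

Lemma cvg_pow2 (u : nat -> R) (l : R) : ((fun n => u n.+1) @ \oo --> l)%classic ->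
  ((fun r => u (2 ^ r)%N) @ \oo --> l)%classic.
Proof.
move=> ul.
rewrite (_ : (fun r => _) = (fun r => u (2 ^ r).-1.+1)); last first.
  by apply/funext => r; rewrite prednK// expn_gt0.
apply: (cvg_subseq (u := fun n => u n.+1)) ul => r.
by rewrite -ltnS prednK ?expn_gt0// ltn_expl.
Qed.

Lemma pole_sum_pair N x :
  pole_sum N x = \sum_(0 <= n < N) ((x + n%:R)^-1 + (x - n.+1%:R)^-1).
Proof.
rewrite /pole_sum big_split/= addrC -addnn (@big_cat_nat _ _ _ N)//= ?leq_addr//.
congr (_ + _).
  rewrite big_nat_rev/= !big_nat; apply: eq_bigr => n /andP[_ nN].
  by rewrite add0n natrB//; congr (_^-1); ring.
rewrite -{1}[N]add0n big_addn addnK; apply: eq_bigr => n _.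
by rewrite natrD addrA addrK.
Qed.

Lemma harmonic_block n p : (0 < p)%N ->
  \sum_(1 <= j < p) ((n * p + j)%:R : R)^-1 =
  H (n.+1 * p) - H (n * p) - ((n.+1 * p)%:R)^-1.
Proof.
case: p => // p _.
have HD M q : H (M + q) = H M + \sum_(1 <= j < q.+1) ((M + j)%:R)^-1.
  elim: q => [|q IH]; first by rewrite big_geq// addn0 addr0.
  by rewrite addnS harmonic_numberS IH [in RHS]big_nat_recr//= addrA -addnS.
rewrite mulSn addnC HD [in RHS]big_nat_recr//=; ring.
Qed.

(** The truncation at [N] of (pi / p) J_p, where each pi cot(pi j / p) is replaced by its pole
    sum. *)
Definition cot_pole_sum p N : R :=
  \sum_(1 <= j < p) j%:R / p%:R * pole_sum N (j%:R / p%:R).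

(* Summed over x = j / p, the terms 1 / (x + n) and 1 / (x - (n + 1)) involve the
   same block of reciprocals, by j |-> p - j. *)
Lemma cot_pole_sum_block p N : (0 < p)%N ->
  cot_pole_sum p N = \sum_(0 <= n < N)
    (2 * p%:R - n.+1%:R^-1 - (n.*2.+1)%:R * p%:R * (H (n.+1 * p) - H (n * p))).
Proof.
move=> p0; have pR : p%:R != 0 :> R by rewrite pnatr_eq0 -lt0n.
rewrite /cot_pole_sum.
under eq_bigr do rewrite pole_sum_pair mulr_sumr.
rewrite exchange_big_nat/=; apply: eq_bigr => n _.
under eq_bigr do rewrite mulrDr.
rewrite big_split/=.
set c := \sum_(1 <= j < p) ((n * p + j)%:R : R)^-1.
have cE : c = H (n.+1 * p) - H (n * p) - ((n.+1 * p)%:R)^-1 by exact: harmonic_block.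
have s1 : \sum_(1 <= j < p) (1 : R) = p%:R - 1.
  by rewrite sumr_const_nat natrB.
(* Each summand is 1 - n p / (n p + j). *)
have -> : \sum_(1 <= j < p) j%:R / p%:R * (j%:R / p%:R + n%:R)^-1 =
    (p%:R - 1) - n%:R * p%:R * c.
  rewrite -s1 mulr_sumr -sumrB !big_nat; apply: eq_bigr => j /andP[j0 _].
  have e0 : n%:R * p%:R + j%:R != 0 :> R.
    by rewrite -natrM -natrD pnatr_eq0 addn_eq0 negb_and -!lt0n j0 orbT.
  rewrite natrD natrM; by field; rewrite pR e0.
(* Each summand is 1 - (n + 1) p / ((n + 1) p - j), with denominator n p + (p - j). *)
have -> : \sum_(1 <= j < p) j%:R / p%:R * (j%:R / p%:R - n.+1%:R)^-1 =
    (p%:R - 1) - n.+1%:R * p%:R * c.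
  rewrite /c -s1 mulr_sumr -sumrB [in RHS]big_nat_rev/= !big_nat.
  apply: eq_bigr => j /andP[j0 jp].
  have -> : ((n * p + (1 + p - j.+1))%:R : R) = n.+1%:R * p%:R - j%:R.
    rewrite add1n subSS natrD natrB 1?ltnW// natrM -natr1; ring.
  have e0 : n.+1%:R * p%:R - j%:R != 0 :> R.
    rewrite -natrM -natrB; last by rewrite (leq_trans (ltnW jp))// mulSn leq_addr.
    by rewrite pnatr_eq0 -lt0n subn_gt0 (leq_trans jp)// mulSn leq_addr.
  have e1 : j%:R / p%:R - n.+1%:R != 0 :> R.
    apply: contraNneq e0 => E; apply/eqP.
    have -> : n.+1%:R * p%:R - j%:R = - (p%:R * (j%:R / p%:R - n.+1%:R)) :> R by field.
    by rewrite E mulr0 oppr0.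
  apply: (mulIf e1); rewrite mulfVK//.
  by move: (n.+1%:R : R) e0 e1 => y e0 e1; field; rewrite pR e0.
rewrite cE natrM -addnn -addSn natrD -[n%:R in RHS](addrK 1) natr1.
have n0 : n.+1%:R != 0 :> R by [].
by rewrite -[n%:R](addrK 1) natr1; move: (n.+1%:R : R) n0 => y y0; field; rewrite pR y0.
Qed.

(** Summation by parts against the weights 2n + 1, using H_0 = 0. *)
Lemma cot_pole_sum_harmonic p N : (0 < p)%N ->
  cot_pole_sum p N = 2 * p%:R * N%:R - H N -
    p%:R * ((2 * N%:R + 1) * H (N * p) - 2 * \sum_(1 <= k < N.+1) H (k * p)).
Proof.
move=> p0; rewrite cot_pole_sum_block//; elim: N => [|N IH].
  by rewrite mul0n /harmonic_number !big_geq//; ring.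
rewrite big_nat_recr//= IH harmonic_numberS [in RHS]big_nat_recr//=.
by rewrite -[N.*2.+1%:R]natr1 -mul2n natrM -[N.+1%:R]natr1; ring.
Qed.

Lemma sum_ln N : \sum_(1 <= k < N.+1) ln k%:R = ln N`!%:R :> R.
Proof.
elim: N => [|N IH]; first by rewrite big_geq// fact0 ln1.
by rewrite big_nat_recr//= IH factS natrM lnM ?posrE ?ltr0n ?fact_gt0// addrC.
Qed.

Lemma harmonic_numberE n : H n = ln n%:R + gamma + (2 * n%:R)^-1 - g n.
Proof. by rewrite /harmonic_error; ring. Qed.

(** The divergent parts combine: the ln k add up to ln N!, which completes [stirling_error], and
    [H N] cancels against the half terms 1 / (2kp). *)
Lemma cot_pole_sumE p N : (0 < p)%N -> (0 < N)%N ->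
  cot_pole_sum p N = 2 * p%:R * stirling_error R N - p%:R * (ln p%:R + gamma) - 1
    - (2 * N%:R)^-1 + p%:R * ((2 * N%:R + 1) * g (N * p))
    - 2 * p%:R * \sum_(1 <= k < N.+1) g (k * p).
Proof.
move=> p0 N0; rewrite cot_pole_sum_harmonic//.
have pR : 0 < p%:R :> R by rewrite ltr0n.
have NR : 0 < N%:R :> R by rewrite ltr0n.
have HE k : (0 < k)%N -> H (k * p) =
    ln k%:R + (ln p%:R + gamma) + (2 * p%:R)^-1 * k%:R^-1 - g (k * p).
  move=> k0; rewrite harmonic_numberE natrM lnM ?posrE ?ltr0n// !addrA.
  by rewrite mulrCA [in LHS]mulrC !invfM.
have -> : \sum_(1 <= k < N.+1) H (k * p) =
    ln N`!%:R + N%:R * (ln p%:R + gamma) + (2 * p%:R)^-1 * H N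
    - \sum_(1 <= k < N.+1) g (k * p).
  rewrite -sum_ln mulr_sumr.
  have -> : N%:R * (ln p%:R + gamma) = \sum_(1 <= k < N.+1) (ln p%:R + gamma).
    by rewrite sumr_const_nat subn1 mulr_natl.
  rewrite -!big_split/= -sumrB !big_nat; apply: eq_bigr => k /andP[k0 _].
  by rewrite HE// mul1r.
rewrite HE// /stirling_error.
move: (ln N`!%:R) (ln (N%:R : R)) (ln (p%:R : R) + gamma) (H N) (g (N * p)) => a c d e f.
move: (\sum_(1 <= k < N.+1) g (k * p)) => G.
by field; rewrite !gt_eqF.
Qed.

Lemma cvg_cot_pole_sum p : (0 < p)%N ->
  ((fun r => cot_pole_sum p (2 ^ r)) @ \oo --> pi / p%:R * J p)%classic.
Proof.
move=> p0; have pR : 0 < p%:R :> R by rewrite ltr0n.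
rewrite /cot_sum mulr_sumr; apply: cvg_sum_nat => j /andP[j0 jp].
have -> : pi / p%:R * (j%:R * cot (j%:R * pi / p%:R)) =
    j%:R / p%:R * (pi * cot (pi * (j%:R / p%:R))) :> R.
  have -> : j%:R * pi / p%:R = pi * (j%:R / p%:R) :> R by ring.
  by ring.
apply: cvgMl_tmp.
have x01 : 0 < (j%:R / p%:R : R) < 1.
  by rewrite divr_gt0 ?ltr0n//= ltr_pdivrMr// mul1r ltr_nat.
apply/cvgrPdist_le => e e0.
have h : ((fun r => cot_lip R / 2 ^+ r) @ \oo --> (0 : R))%classic.
  rewrite -(mulr0 (cot_lip R)); apply: cvgMl_tmp.
  under eq_fun do rewrite -exprVn.
  by apply: cvg_expr; rewrite ger0_norm// invf_lt1 ?ltr1n.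
move/cvgrPdist_le : h => /(_ e e0); apply: filterS => r.
rewrite sub0r normrN => h; apply: le_trans (cot_expansion r x01) _.
by apply: le_trans h; exact: ler_norm.
Qed.

Lemma harmonic_error_gt0 n : (0 < n)%N -> 0 < g n.
Proof.
move=> n0; have := harmonic_error_sign R 0 n0.
by rewrite /harmonic_series big_geq// subr0 expr0 mul1r.
Qed.

Lemma harmonic_error_lt n : (0 < n)%N -> g n < b 2 / 2 * n%:R ^- 2.
Proof.
move=> n0; have := harmonic_error_sign R 1 n0.
by rewrite /harmonic_series big_nat1 expr1 mulN1r oppr_gt0 subr_lt0.
Qed.

Lemma cvg_harmonic_error_tail p : (0 < p)%N ->
  ((fun n => (2 * n.+1%:R + 1) * g (n.+1 * p)) @ \oo --> 0)%classic.
Proof.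
(* The sign of [b 2] is read off from 0 < g 1 < b 2 / 2. *)
move=> p0; have b0 : 0 < b 2 / 2.
  have := lt_trans (harmonic_error_gt0 (ltn0Sn 0)) (harmonic_error_lt (ltn0Sn 0)).
  by rewrite expr1n invr1 mulr1.
have h : ((fun n => 3 * (b 2 / 2) * harmonic n) @ \oo --> (0 : R))%classic.
  by rewrite -(mulr0 (3 * (b 2 / 2))); apply: cvgMl_tmp; exact: cvg_harmonic.
apply: (squeeze_cvgr _ (cvg_cst 0) h); near=> n.
have np0 : (0 < n.+1 * p)%N by rewrite muln_gt0.
have y0 : 0 < n.+1%:R :> R by [].
have y1 : 1 <= n.+1%:R :> R by rewrite ler1n.
have y2 : 0 <= 2 * n.+1%:R + 1 :> R by lra.
have g0 := ltW (harmonic_error_gt0 np0); rewrite mulr_ge0//=.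
have gle : g (n.+1 * p) <= b 2 / 2 * n.+1%:R ^- 2.
  apply: le_trans (ltW (harmonic_error_lt np0)) _; rewrite ler_pM2l//.
  rewrite lef_pV2 ?posrE ?exprn_gt0// ?ltr0n// ler_pXn2r ?nnegrE// ler_nat.
  by rewrite leq_pmulr.
apply: le_trans (_ : 3 * n.+1%:R * (b 2 / 2 * n.+1%:R ^- 2) <= _).
  by apply: ler_pM => //; lra.
rewrite /harmonic/= le_eqVlt; apply/orP; left; apply/eqP.
by move: (n.+1%:R : R) y0 => y y0; field; rewrite gt_eqF.
Unshelve. all: by end_near.
Qed.

(** [cot_pole_sumE] is solved for the sum of the g (k p) and passed to the limit along N = 2^r,
    where the cotangent expansion is available. *)
Lemma cvg_sum_harmonic_error p : (0 < p)%N ->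
  ((fun r => 2 * \sum_(1 <= k < (2 ^ r).+1) g (k * p)) @ \oo -->
    ln (2 * pi) - (ln p%:R + gamma) - p%:R^-1 - pi / p%:R ^+ 2 * J p)%classic.
Proof.
move=> p0; have pR : 0 < p%:R :> R by rewrite ltr0n.
have E r : 2 * \sum_(1 <= k < (2 ^ r).+1) g (k * p) =
   p%:R^-1 * (2 * p%:R * stirling_error R (2 ^ r) + - (p%:R * (ln p%:R + gamma) + 1)
    - (2 * (2 ^ r)%:R)^-1 + p%:R * ((2 * (2 ^ r)%:R + 1) * g (2 ^ r * p))
    - cot_pole_sum p (2 ^ r)).
  rewrite cot_pole_sumE// ?expn_gt0//.
  move: (\sum_(1 <= k < (2 ^ r).+1) g (k * p)) (g (2 ^ r * p)) (stirling_error R (2 ^ r)) => x y z.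
  by move: ((2 * (2 ^ r)%:R)^-1) ((2 * (2 ^ r)%:R + 1)) => u v; field; rewrite gt_eqF.
under eq_fun do rewrite E.
have -> : ln (2 * pi) - (ln p%:R + gamma) - p%:R^-1 - pi / p%:R ^+ 2 * J p =
  p%:R^-1 * (2 * p%:R * (2^-1 * ln (2 * pi)) + - (p%:R * (ln p%:R + gamma) + 1) - 0 + p%:R * 0
    - pi / p%:R * J p).
  by field; rewrite gt_eqF.
apply: cvgMl_tmp; apply: cvgB; last exact: cvg_cot_pole_sum.
apply: cvgD; last first.
  apply: cvgMl_tmp; apply: (cvg_pow2 (u := fun N => (2 * N%:R + 1) * g (N * p))).
  exact: cvg_harmonic_error_tail.
apply: cvgB.
  apply: cvgD; last exact: cvg_cst.
  by apply: cvgMl_tmp; apply: (cvg_pow2 (u := stirling_error R)); exact: cvg_stirling_error.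
apply: (cvg_pow2 (u := fun N => (2 * N%:R)^-1)).
under eq_fun do rewrite invfM.
by rewrite -(mulr0 2^-1); apply: cvgMl_tmp; exact: cvg_harmonic.
Qed.

(** * Zeta values, and the sign of the error *)

Lemma sum_expV_le n k : \sum_(0 <= i < n.+1) i.+1%:R ^- k.+2 <= 2 - n.+1%:R^-1 :> R.
Proof.
elim: n => [|n IH]; first by rewrite big_nat1 expr1n invr1; lra.
rewrite big_nat_recr//=.
apply: le_trans (lerD IH (_ : _ <= n.+1%:R^-1 - n.+2%:R^-1)) _; last first.
  by rewrite addrA subrK.
have y0 : 0 < n.+1%:R :> R by [].
rewrite -[n.+2%:R]natr1; move: (n.+1%:R : R) y0 => y y0.
have -> : y^-1 - (y + 1)^-1 = (y * (y + 1))^-1 by field; rewrite !gt_eqF//; lra.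
have y1 : 0 < y + 1 by lra.
rewrite lef_pV2 ?posrE ?exprn_gt0 ?mulr_gt0//.
apply: (@le_trans _ _ ((y + 1) ^+ 2)); first by rewrite expr2 ler_pM2r//; lra.
by rewrite ler_weXn2l//; lra.
Qed.

(** [zeta] is a bare [limn]; bounded partial sums make it a genuine limit at positive even
    arguments. *)
Lemma cvg_zeta k : (0 < k)%N ->
  ((fun n => \sum_(1 <= i < n.+1) i%:R ^- k.*2) @ \oo --> zeta (k.*2%:R : R))%classic.
Proof.
case: k => // k _.
have -> : zeta (k.+1.*2%:R : R) = limn (series (fun n => n.+1%:R ^- k.+1.*2 : R)).
  congr (limn (series _)); apply/funext => n.
  by rewrite powRN powR_mulrn.
rewrite (_ : (fun n => _) = series (fun n => n.+1%:R ^- k.+1.*2)); last first.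
  by apply/funext => n; rewrite seriesEnat /= big_add1.
have nd : nondecreasing_seq (series (fun n => n.+1%:R ^- k.+1.*2 : R)).
  by apply: nondecreasing_series => n _ _; rewrite invr_ge0 exprn_ge0.
apply: nondecreasing_is_cvgn => //.
exists 2 => _ [n _ <-]; apply: le_trans (nd n n.+1 (leqnSn n)) _.
rewrite seriesEnat /= doubleS; apply: le_trans (sum_expV_le n k.*2) _.
by rewrite gerBl invr_ge0.
Qed.

Lemma zeta_ge0 k : (0 < k)%N -> 0 <= zeta (k.*2)%:R :> R.
Proof.
move=> k0; apply: (ler_cvg_to (cvg_cst 0) (cvg_zeta k0)).
by apply: nearW => n; apply: sumr_ge0 => i _; rewrite invr_ge0 exprn_ge0.
Qed.

(* With theta as in the paper, this is pi * theta_(p, m + 1) / p ^ (2 (m + 1)). *)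
Definition cot_sum_error p m : R := (-1) ^+ m *
  (ln (2 * pi) - H p - (2 * p%:R)^-1 - pi / p%:R ^+ 2 * J p -
   \sum_(1 <= k < m.+1) b k.*2 / k.*2%:R * (1 + 2 * zeta (k.*2)%:R) * p%:R ^- k.*2).

(** The error is e(p) plus the limit of twice the sum of the e(kp), where each e is positive by
    [harmonic_error_sign]. The limit is only known to be >= 0, so e(p) gives strictness. *)
Lemma cot_sum_error_gt0 p m : (0 < p)%N -> 0 < cot_sum_error p m.
Proof.
move=> p0; pose e n := (-1) ^+ m * (g n - harmonic_series R m.+1 n).
have e0 n : (0 < n)%N -> 0 < e n by exact: harmonic_error_sign.
have lim : ((fun r => 2 * \sum_(1 <= k < (2 ^ r).+1) e (k * p)) @ \oo -->
   cot_sum_error p m - e p)%classic.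
  have E r : 2 * \sum_(1 <= k < (2 ^ r).+1) e (k * p) =
    (-1) ^+ m * (2 * \sum_(1 <= k < (2 ^ r).+1) g (k * p) -
      \sum_(1 <= j < m.+1) 2 * (b j.*2 / j.*2%:R) * p%:R ^- j.*2 *
         \sum_(1 <= k < (2 ^ r).+1) k%:R ^- j.*2).
    rewrite /e -mulr_sumr mulrCA sumrB mulrBr; congr (_ * (_ - _)).
    rewrite /harmonic_series exchange_big_nat/= mulr_sumr; apply: eq_bigr => j _.
    rewrite !mulr_sumr; apply: eq_bigr => k _.
    by rewrite natrM exprMn invfM; ring.
  under eq_fun do rewrite E.
  have -> : cot_sum_error p m - e p = (-1) ^+ m *
      ((ln (2 * pi) - (ln p%:R + gamma) - p%:R^-1 - pi / p%:R ^+ 2 * J p) -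
       \sum_(1 <= j < m.+1) 2 * (b j.*2 / j.*2%:R) * p%:R ^- j.*2 * zeta (j.*2)%:R).
    rewrite /cot_sum_error /e -mulrBr; congr (_ * _).
    have -> : \sum_(1 <= k < m.+1) b k.*2 / k.*2%:R * (1 + 2 * zeta (k.*2)%:R) * p%:R ^- k.*2 =
      harmonic_series R m.+1 p +
      \sum_(1 <= j < m.+1) 2 * (b j.*2 / j.*2%:R) * p%:R ^- j.*2 * zeta (j.*2)%:R.
      by rewrite /harmonic_series -big_split/=; apply: eq_bigr => j _; ring.
    by rewrite /harmonic_error; field; rewrite pnatr_eq0 -lt0n.
  apply: cvgMl_tmp; apply: cvgB; first exact: cvg_sum_harmonic_error.
  apply: cvg_sum_nat => j /andP[j0 _]; apply: cvgMl_tmp.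
  apply: (cvg_subseq (u := fun n => \sum_(1 <= i < n.+1) i%:R ^- j.*2)); last exact: cvg_zeta.
  by move=> r; rewrite ltnW// ltn_expl.
apply: lt_le_trans (e0 p p0) _; rewrite -subr_ge0.
apply: (ler_cvg_to (cvg_cst 0) lim); apply: nearW => r.
rewrite mulr_ge0// big_nat; apply: sumr_ge0 => k /andP[k0 _].
by rewrite ltW// e0// muln_gt0 k0.
Qed.

(** Consecutive errors carry opposite signs, so everything cancels except the term that separates
    the two partial sums. As both errors are positive, this bounds each of them above. *)
Lemma cot_sum_errorS p m : cot_sum_error p m + cot_sum_error p m.+1 =
  (-1) ^+ m * b m.+1.*2 * (1 + 2 * zeta (m.+1.*2)%:R) / m.+1.*2%:R * p%:R ^- m.+1.*2.
Proof.
rewrite /cot_sum_error [(-1) ^+ m.+1]exprS mulN1r (@big_nat_recr _ _ _ m.+1)//=; ring.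
Qed.

End CotangentSum.

Unset Implicit Arguments.

Theorem proposition9p2 (R : realType) (p m : nat)
    (hp : (0 < p)%N) (hm : (0 < m)%N) :
  exists theta : R,
    cot_sum R p =
      - (1 / pi) * p%:R ^+ 2 * harmonic_number R p
      + ln (2 * pi) / pi * p%:R ^+ 2
      - p%:R / (2 * pi)
      - \sum_(1 <= k < m)
          bernoulli_number R (2 * k) * (1 + 2 * zeta (2 * k)%:R)
            / (2 * pi * k%:R * p%:R ^+ (2 * k - 2))
      + (- 1) ^+ m / p%:R ^+ (2 * m - 2) * theta
    /\ 0 < theta
    /\ theta < `|bernoulli_number R (2 * m)| * (1 + 2 * zeta (2 * m)%:R)
                 / (2 * pi * m%:R).
Proof.
(* From here the m of the theorem is [m.+1], so its sum over [k < m.+1] is the one inside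
   [cot_sum_error R p m]. *)
case: m hm => // m _.
have pR : 0 < p%:R :> R by rewrite ltr0n.
have pi0 := pi_gt0 R.
have c0 : 0 < p%:R ^+ m.+1.*2 / pi :> R by rewrite divr_gt0// exprn_gt0.
exists (p%:R ^+ m.+1.*2 / pi * cot_sum_error R p m); split; last split.
- have -> : \sum_(1 <= k < m.+1) bernoulli_number R (2 * k) * (1 + 2 * zeta (2 * k)%:R)
      / (2 * pi * k%:R * p%:R ^+ (2 * k - 2)) = p%:R ^+ 2 / pi *
    \sum_(1 <= k < m.+1) bernoulli_number R k.*2 / k.*2%:R * (1 + 2 * zeta (k.*2)%:R)
      * p%:R ^- k.*2.
    rewrite mulr_sumr !big_nat; apply: eq_bigr => -[//|k] _.
    have e : k.+1.*2%:R = 2 * k.+1%:R :> R by rewrite -mul2n natrM.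
    rewrite mul2n e doubleS subn2 /= -[in p%:R ^+ k.*2.+2]addn2 exprD.
    move: (bernoulli_number R _) (zeta _) => u v.
    have : k.+1%:R != 0 :> R by [].
    move: (k.+1%:R : R) (p%:R ^+ k.*2) (expf_neq0 k.*2 (lt0r_neq0 pR)) => y z z0 y0.
    move: (p%:R : R) (pi : R) (lt0r_neq0 pR) (lt0r_neq0 pi0) => x q x0 q0.
    by field; rewrite z0 y0 x0 q0.
  have -> : (-1) ^+ m.+1 / p%:R ^+ (2 * m.+1 - 2) *
      (p%:R ^+ m.+1.*2 / pi * cot_sum_error R p m) =
      - ((-1) ^+ m * (-1) ^+ m) * (p%:R ^+ 2 / pi *
     (ln (2 * pi) - harmonic_number R p - (2 * p%:R)^-1 - pi / p%:R ^+ 2 * cot_sum R p -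
   \sum_(1 <= k < m.+1) bernoulli_number R k.*2 / k.*2%:R * (1 + 2 * zeta (k.*2)%:R) * p%:R ^- k.*2)).
    rewrite /cot_sum_error mul2n doubleS subn2 /= -[in p%:R ^+ m.*2.+2]addn2 exprD.
    rewrite [(-1) ^+ m.+1]exprS mulN1r.
    move: (_ - _) ((-1) ^+ m : R) => X s.
    move: (p%:R ^+ m.*2) (expf_neq0 m.*2 (lt0r_neq0 pR)) => z z0.
    by move: (pi : R) (lt0r_neq0 pi0) => q q0; field; rewrite z0 q0.
  rewrite -expr2 sqrr_sign.
  move: (\sum_(1 <= k < m.+1) _) (cot_sum R p) (ln _) (harmonic_number R p) => S J l H.
  move: (p%:R : R) (pi : R) (lt0r_neq0 pR) (lt0r_neq0 pi0) => x q x0 q0.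
  by field; rewrite x0 q0.
- by rewrite mulr_gt0// cot_sum_error_gt0.
have T0 : 0 < p%:R ^+ m.+1.*2 / pi * cot_sum_error R p m.+1.
  by rewrite mulr_gt0// cot_sum_error_gt0.
(* Adding the next, positive error turns the left side into the exact omitted term; the absolute
   value then enters through (-1)^m b <= |b|. *)
rewrite -(ltrD2r (p%:R ^+ m.+1.*2 / pi * cot_sum_error R p m.+1)) -mulrDr cot_sum_errorS.
apply: le_lt_trans (_ : _ <= `|bernoulli_number R (2 * m.+1)| *
  (1 + 2 * zeta (2 * m.+1)%:R) / (2 * pi * m.+1%:R)) _; last by rewrite ltrDl.
rewrite mul2n; set z := zeta _.
have z0 : 0 <= 1 + 2 * z by have := @zeta_ge0 R m.+1 isT; rewrite -/z; lra.
have m0 : 0 < m.+1%:R :> R by [].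
have -> : p%:R ^+ m.+1.*2 / pi * ((-1) ^+ m * bernoulli_number R m.+1.*2 * (1 + 2 * z)
    / m.+1.*2%:R / p%:R ^+ m.+1.*2) =
  (-1) ^+ m * bernoulli_number R m.+1.*2 * ((1 + 2 * z) / (2 * pi * m.+1%:R)).
  rewrite -[in m.+1.*2%:R]mul2n natrM; move: (bernoulli_number R _) ((-1) ^+ m : R) => u s.
  move: (p%:R ^+ m.+1.*2) (expf_neq0 m.+1.*2 (lt0r_neq0 pR)) => y y0.
  move: (m.+1%:R : R) (pi : R) (lt0r_neq0 m0) (lt0r_neq0 pi0) => M q M0 q0.
  by field; rewrite M0 q0 y0.
rewrite -[leRHS]mulrA ler_wpM2r//.
  by rewrite divr_ge0// ltW// !mulr_gt0.
by apply: le_trans (ler_norm _) _; rewrite normrMsign.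
Qed.
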